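(* Let $F_{4,2}$ be the $3$-graph on $\{1,\dots,6\}$ with edges $\{123,124,134,156,256,356,456\}$ and let $F_{3,3}$ be the $3$-graph on $\{1,\dots,6\}$ with edges $\{123\}\cup\{xyz : x\in\{1,2,3\},\ \{y,z\}\subseteq\{4,5,6\}\}$. Then \[\pi(F_{4,2}) \leq 0.4933327,\qquad \gamma(F_{4,2}) \leq 0.4185,\qquad \gamma^+(F_{3,3}) \leq 0.616.\]
   Context: For a $3$-graph $F$: $\mathrm{ex}(n,F)$ is the maximum number of edges of an $n$-vertex $F$-free $3$-graph and $\pi(F)=\lim_{n\to\infty}\mathrm{ex}(n,F)/\binom{n}{3}$ (Turán density). The minimum co-degree $\delta_2(H)$ of a $3$-graph $H$ is the minimum over all pairs of vertices of the number of edges containing the pair; $\mathrm{coex}(n,F)$ is the maximum of $\delta_2(H)$ over $n$-vertex $F$-free $3$-graphs and $\gamma(F)=\lim_{n\to\infty}\mathrm{coex}(n,F)/n$. The minimum positive co-degree $\delta_2^+(H)$ is the largest $k$ such that every pair contained in some edge is contained in at least $k$ edges ($0$ for the edgeless graph); $\mathrm{co^+ex}(n,F)$ is the maximum of $\delta_2^+(H)$ over $n$-vertex $F$-free $3$-graphs and $\gamma^+(F)=\lim_{n\to\infty}\mathrm{co^+ex}(n,F)/n$. Here $F$-free means containing no (not necessarily induced) copy of $F$; all these limits exist. *)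

(* Defs.v *)
From HB Require Import structures.
From mathcomp Require Import all_boot all_order all_algebra.
From mathcomp Require Import reals topology normedtype.
From mathcomp Require Import sequences.

Set Implicit Arguments.
Unset Strict Implicit.
Unset Printing Implicit Defensive.

Import Order.TTheory GRing.Theory Num.Theory.
Import numFieldNormedType.Exports.

Local Open Scope nat_scope.

Definition uniform3 (V : finType) (E : {set {set V}}) : bool :=
  [forall e in E, #|e| == 3].

Record threegraph (V : finType) := ThreeGraph {
  edges :> {set {set V}};
  edges_uniform3 : uniform3 edges
}.

HB.instance Definition _ (V : finType) := [isSub for @edges V].
HB.instance Definition _ (V : finType) := [Finite of threegraph V by <:].

Section Invariants.
Variables (U V : finType).

(* Not necessarily induced copy: an injection of the vertices which maps every
   edge of [F] to an edge of [H]. *)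
Definition contains_copy (H : threegraph V) (F : threegraph U) : bool :=
  [exists f : {ffun U -> V},
    injectiveb f && [forall e in edges F, f @: e \in edges H]].

Definition codegree (H : threegraph V) (p : {set V}) : nat :=
  #|[set e in edges H | p \subset e]|.

(* No co-degree exceeds [#|V|], so the starting value [#|V|] does not affect
   the minimum as soon as there is a pair of vertices, i.e. [#|V| >= 2]. *)
Definition min_codegree (H : threegraph V) : nat :=
  \big[minn/#|V|]_(p : {set V} | #|p| == 2) codegree H p.

(* The largest [k] is searched among [k <= #|V|], which bounds every co-degree. *)
Definition min_pos_codegree (H : threegraph V) : nat :=
  if edges H == set0 then 0 else
  \max_(k < #|V|.+1 |
        [forall p : {set V}, (#|p| == 2) ==>
           [exists e in edges H, p \subset e] ==> (k <= codegree H p)]) k.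

End Invariants.

Section Extremal.
Variables (U : finType) (F : threegraph U).

Definition turan_number (n : nat) : nat :=
  \max_(H : threegraph 'I_n | ~~ contains_copy H F) #|edges H|.

Definition coex (n : nat) : nat :=
  \max_(H : threegraph 'I_n | ~~ contains_copy H F) min_codegree H.

Definition pos_coex (n : nat) : nat :=
  \max_(H : threegraph 'I_n | ~~ contains_copy H F) min_pos_codegree H.

End Extremal.

Section Densities.
Variables (R : realType) (U : finType) (F : threegraph U).
Local Open Scope ring_scope.

(* [limn] is total: it has a default value on divergent sequences. The three
   sequences below are known to converge for every 3-graph [F]. *)
Definition turan_density : R :=
  limn (fun n : nat => (turan_number F n)%:R / ('C(n, 3))%:R : R).

Definition codegree_density : R :=
  limn (fun n : nat => (coex F n)%:R / n%:R : R).

Definition pos_codegree_density : R :=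
  limn (fun n : nat => (pos_coex F n)%:R / n%:R : R).

End Densities.

(* The vertex labelled [k] in {1, ..., 6} is the element [k - 1] of ['I_6]. *)
Definition vtx (k : nat) : 'I_6 := inord k.-1.

Definition tri (a b c : nat) : {set 'I_6} := [set vtx a; vtx b; vtx c].

Definition F42_edges : {set {set 'I_6}} :=
  [set tri 1 2 3; tri 1 2 4; tri 1 3 4;
       tri 1 5 6; tri 2 5 6; tri 3 5 6; tri 4 5 6].

Definition F33_edges : {set {set 'I_6}} :=
  tri 1 2 3 |:
  [set x |: yz | x in tri 1 2 3,
                 yz in [set yz : {set 'I_6} | yz \subset tri 4 5 6 & #|yz| == 2]].

Lemma card_tri a b c :
  0 < a -> a < b -> b < c -> c <= 6 -> #|tri a b c| = 3.
Proof.
move=> a0 ab bc c6.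
have vE k : 0 < k -> k <= 6 -> val (vtx k) = k.-1.
  by case: k => // k _ k6; rewrite /= inordK.
have vN i j : 0 < i -> i < j -> j <= 6 -> vtx i != vtx j.
  move=> i0 ij j6; rewrite -val_eqE !vE //; last 2 first.
  - exact: leq_trans i0 (ltnW ij).
  - exact: leq_trans (ltnW ij) j6.
  by case: i i0 ij => // i _; case: j j6 => //= j _ ij; rewrite ltn_eqF.
have b0 : 0 < b by exact: ltn_trans ab.
have b6 : b <= 6 by exact: leq_trans (ltnW bc) c6.
rewrite /tri -setUA cardsU1 cards2 vN // !inE negb_or !vN //.
exact: ltn_trans bc.
Qed.

Lemma F42_uniform3 : uniform3 F42_edges.
Proof.
apply/forall_inP => e; rewrite !inE -!orbA.
by do ![case/orP]; move=> /eqP->; rewrite card_tri.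
Qed.

Lemma F33_uniform3 : uniform3 F33_edges.
Proof.
apply/forall_inP => e; rewrite inE => /orP[|/imset2P[x yz xA]].
  by rewrite inE => /eqP->; rewrite card_tri.
rewrite inE => /andP[/subsetP yzB /eqP yz2] ->; rewrite cardsU1 yz2.
suff -> : x \notin yz by [].
apply/negP => /yzB; move: xA; rewrite !inE -!val_eqE /= !inordK //.
by case: x => [[|[|[|x]]]].
Qed.

Definition F42 : threegraph 'I_6 := ThreeGraph F42_uniform3.
Definition F33 : threegraph 'I_6 := ThreeGraph F33_uniform3.

(* Main.v *)
Require Import Defs.
From Stdlib Require Import ZArith.
From mathcomp Require Import all_boot all_order all_algebra.
From mathcomp Require Import fingroup perm.
From mathcomp Require Import zify ssrZ ring lra.
From mathcomp Require Import boolp reals topology normedtype sequences.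
Import GRing.Theory Num.Theory.
Import Order.TTheory.

(** All three bounds are flag algebra arguments on 6 vertices.  Vertices are
    sampled with replacement, so a 3-graph [H] on [n] vertices gives [n ^ 6]
    patterns of six vertices; as every pair of vertices of [F42] or of [F33] lies
    in an edge, each of these patterns, repetitions included, is again free.
    An integer function [phi] of the pattern whose sums over the relabellings of
    every free pattern are nonnegative has a nonnegative sum over all 6-tuples,
    and this finite condition is checked by computation.  Each [phi] is the
    required bound minus terms whose sum over all 6-tuples is nonnegative: sums of
    squares of 5-vertex flags over a 4-vertex type and, for the codegree bounds,
    nonnegative multiples of [d(1,2) - gamma * n].

    This alone proves [pi(F42) <= 0.49333278], which is slightly too weak.  The
    extremal pseudo-structure is a blow-up of the complete 3-graph on 5 vertices
    whose parts carry 3-graphs of density 1/3, whereas these 3-graphs have to be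
    free of K4^-: if [123] is an edge, the vertices [x] such that [12x] is an edge
    and [13x], [23x] are not all lie in the neighbourhood of the pair [12], where
    a K4^- would complete an [F42].  A separate certificate gives 0.301 as an
    upper bound for the density of K4^- -free 3-graphs, and the resulting
    inequality is one more term of [phi]. *)

Set Implicit Arguments.
Unset Strict Implicit.
Unset Printing Implicit Defensive.

Delimit Scope Z_scope with Z.
Local Open Scope nat_scope.

(** * Patterns and their relabellings *)

(* The colexicographic order: the first 10 triples are those of the first five
   vertices, the first 4 give the type of the vertices 0, .., 3, and the entries
   4 to 9 and 10 to 15 are the flags of the vertices 4 and 5 over this type. *)
Definition triples : seq (nat * nat * nat) :=
  [:: (0, 1, 2);
      (0, 1, 3); (0, 2, 3); (1, 2, 3);
      (0, 1, 4); (0, 2, 4); (1, 2, 4); (0, 3, 4); (1, 3, 4); (2, 3, 4);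
      (0, 1, 5); (0, 2, 5); (1, 2, 5); (0, 3, 5); (1, 3, 5); (2, 3, 5);
      (0, 4, 5); (1, 4, 5); (2, 4, 5); (3, 4, 5)].

Definition triple_index (i j k : nat) : nat :=
  find (fun t => perm_eq [:: t.1.1; t.1.2; t.2] [:: i; j; k]) triples.

Definition relabelling (p : seq nat) : seq nat :=
  [seq triple_index (nth 0 p t.1.1) (nth 0 p t.1.2) (nth 0 p t.2)
  | t <- triples].

Definition relabel (b : seq bool) (r : seq nat) : seq bool :=
  [seq nth false b i | i <- r].

Definition perms6 : seq (seq nat) := permutations (iota 0 6).

Section Pattern.
Variables (V : Type) (h : V -> V -> V -> bool).
Definition pattern (y : nat -> V) : seq bool :=
  [seq h (y t.1.1) (y t.1.2) (y t.2) | t <- triples].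

Hypothesis hC : forall a b c, h a b c = h b a c.
Hypothesis hCA : forall a b c, h a b c = h a c b.
Hypothesis hirr : forall a c, h a a c = false.

(** Symmetry of [h] makes the order of the three indices irrelevant. If two of them coincide,
    [triple_index] returns 20, past the end, and the default [false] is the value that irreflexivity
    prescribes. *)
Lemma nth_pattern y i j k : i < 6 -> j < 6 -> k < 6 ->
  nth false (pattern y) (triple_index i j k) = h (y i) (y j) (y k).
Proof.
have h2 a c : h a c c = false by rewrite hC hCA hirr.
have h3 a c : h a c a = false by rewrite hCA hirr.
have h312 a b c : h c a b = h a b c by rewrite hC hCA.
have h231 a b c : h b c a = h a b c by rewrite hCA hC.
have h321 a b c : h c b a = h a b c by rewrite hC h231.
do 6?[case: i => [|i]] => //; do 6?[case: j => [|j]] => //;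
  do 6?[case: k => [|k]] => // _ _ _;
  rewrite ?hirr ?h2 ?h3 /triple_index /= //;
  by [rewrite -hC | rewrite -hCA | rewrite -h312 | rewrite -h231 | rewrite -h321].
Qed.

Lemma relabel_pattern y p : size p = 6 -> all (ltn^~ 6) p ->
  relabel (pattern y) (relabelling p) = pattern (fun i => y (nth 0 p i)).
Proof.
move=> sp /all_nthP p6; rewrite /relabel /relabelling -map_comp.
have {}p6 i : i < 6 -> nth 0 p i < 6 by move=> i6; apply: p6; rewrite sp.
apply/eq_in_map => -[[i j] k]; rewrite !inE => ijk /=.
have [i6 j6 k6] : [/\ i < 6, j < 6 & k < 6].
  by move: ijk; do ?[case/orP]; move=> /eqP[-> -> ->].
by rewrite nth_pattern ?p6.
Qed.
End Pattern.

Definition perm_seq (s : 'S_6) : seq nat := [seq val (s (inord i)) | i <- iota 0 6].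

Lemma size_perm_seq s : size (perm_seq s) = 6.
Proof. by rewrite size_map size_iota. Qed.

Lemma nth_perm_seq s (i : 'I_6) : nth 0 (perm_seq s) i = s i.
Proof. by rewrite (nth_map 0) ?size_iota // nth_iota // add0n inord_val. Qed.

Lemma perm_seq_inj : injective perm_seq.
Proof.
move=> s t st; apply/permP => i; apply: val_inj => /=.
by rewrite -!nth_perm_seq st.
Qed.

Lemma perm_seq_lt s : all (ltn^~ 6) (perm_seq s).
Proof. by apply/allP => _ /mapP[i _ ->]; exact: ltn_ord. Qed.

(** Turns sums over the computed list into sums over the group, which can be reindexed by
    translation. The sequences [perm_seq s] are distinct members of [perms6], and both lists have 6!
    elements. *)
Lemma perms6E : perm_eq perms6 [seq perm_seq s | s : 'S_6].
Proof.
have u : uniq [seq perm_seq s | s : 'S_6].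
  by rewrite map_inj_uniq ?enum_uniq //; exact: perm_seq_inj.
have sub : {subset [seq perm_seq s | s : 'S_6] <= perms6}.
  move=> _ /mapP[s _ ->]; rewrite mem_permutations; apply: uniq_perm.
  - rewrite map_inj_in_uniq ?iota_uniq // => i j; rewrite !mem_iota => i6 j6 /val_inj/perm_inj.
    by move=> /(congr1 (@nat_of_ord 6)); rewrite !inordK.
  - exact: iota_uniq.
  move=> i; rewrite mem_iota; apply/mapP/idP => [[j _ ->]|i6]; first exact: ltn_ord.
  exists (val (s^-1%g (inord i))); first by rewrite mem_iota; exact: ltn_ord.
  by rewrite inord_val permKV; rewrite /= inordK.
rewrite perm_sym; apply: (uniq_perm u); first by rewrite /perms6 permutations_uniq.
suff le : size perms6 <= size [seq perm_seq s | s : 'S_6].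
  by have [_ eqp] := uniq_min_size u sub le.
rewrite /perms6 size_permutations ?iota_uniq // size_map -cardE size_iota.
by rewrite -(card_Sn 6) cardE.
Qed.

(** * The lexicographic order on patterns *)

Fixpoint lexle (s t : seq bool) : bool :=
  match s, t with
  | a :: s', b :: t' => if a then (if b then lexle s' t' else false)
                        else (if b then true else lexle s' t')
  | _, _ => true
  end.

(** The binary number with the head as most significant bit. It transports the lexicographic order
    to [nat], where [arg max] picks a maximal relabelling. *)
Fixpoint code (s : seq bool) : nat :=
  if s is a :: s' then a * 2 ^ size s' + code s' else 0.

Lemma code_lt s : code s < 2 ^ size s.
Proof.
elim: s => [//|a s IH]; rewrite [size _]/=; rewrite expnS [code _]/=.
by case: a; rewrite ?mul1n ?mul0n; lia.
Qed.

Lemma lexle_code s t : size s = size t -> code s <= code t -> lexle s t.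
Proof.
elim: s t => [|a s IH] [|b t] //= [st]; have := code_lt s; have := code_lt t; rewrite st.
by case: a; case: b => /=; rewrite ?mul1n ?mul0n => s1 t1 le; try (apply: IH => //); lia.
Qed.

Lemma lexle_cat s s' t t' : size s = size t -> lexle (s ++ s') (t ++ t') -> lexle s t.
Proof. by elim: s t => [|[] s IH] [|[] t] //= [/IH]. Qed.

(** * Checking a certificate *)

Definition involution (p : seq nat) : bool :=
  [seq nth 0 p (nth 0 p i) | i <- iota 0 6] == iota 0 6.

(* The three functions below are evaluated on formal bits once and for all, so
   that the check of the certificates never computes an index. *)
Definition relabellings_fun := Eval vm_compute in
  fun b0 b1 b2 b3 b4 b5 b6 b7 b8 b9 b10 b11 b12 b13 b14 b15 b16 b17 b18 b19 =>
  [seq relabel [:: b0; b1; b2; b3; b4; b5; b6; b7; b8; b9;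
                   b10; b11; b12; b13; b14; b15; b16; b17; b18; b19]
     (relabelling p) | p <- perms6].

Definition involutes_fun := Eval vm_compute in
  fun b0 b1 b2 b3 b4 b5 b6 b7 b8 b9 b10 b11 b12 b13 b14 b15 b16 b17 b18 b19 =>
  [seq relabel [:: b0; b1; b2; b3; b4; b5; b6; b7; b8; b9;
                   b10; b11; b12; b13; b14; b15; b16; b17; b18; b19]
     (relabelling p) | p <- perms6 & involution p].

Definition prefix_involutes_fun := Eval vm_compute in
  fun b0 b1 b2 b3 b4 b5 b6 b7 b8 b9 =>
  [seq relabel [:: b0; b1; b2; b3; b4; b5; b6; b7; b8; b9]
     (take 10 (relabelling p)) | p <- perms6 & involution p && (nth 0 p 5 == 5)].

Definition app10 (A : Type) (d : A)
    (f : bool -> bool -> bool -> bool -> bool ->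
         bool -> bool -> bool -> bool -> bool -> A) (b : seq bool) : A :=
  if b is [:: b0; b1; b2; b3; b4; b5; b6; b7; b8; b9]
  then f b0 b1 b2 b3 b4 b5 b6 b7 b8 b9 else d.

Definition relabellings (l m : seq bool) : seq (seq bool) :=
  app10 [::] (app10 (fun _ _ _ _ _ _ _ _ _ _ => [::]) relabellings_fun l) m.
Definition involutes (l m : seq bool) : seq (seq bool) :=
  app10 [::] (app10 (fun _ _ _ _ _ _ _ _ _ _ => [::]) involutes_fun l) m.
Definition prefix_involutes : seq bool -> seq (seq bool) :=
  app10 [::] prefix_involutes_fun.

Lemma size10P (T : Type) (l : seq T) : size l = 10 ->
  exists b0 b1 b2 b3 b4 b5 b6 b7 b8 b9,
    l = [:: b0; b1; b2; b3; b4; b5; b6; b7; b8; b9].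
Proof.
do 10![case: l => // ? l]; case: l => // _; do 10 eexists; reflexivity.
Qed.

(** Once the twenty bits are variables, both sides compute to the same list of 720 patterns. *)
Lemma relabellingsE l m : size l = 10 -> size m = 10 ->
  relabellings l m = [seq relabel (l ++ m) (relabelling p) | p <- perms6].
Proof.
move=> /size10P[b0 [b1 [b2 [b3 [b4 [b5 [b6 [b7 [b8 [b9 ->]]]]]]]]]].
move=> /size10P[c0 [c1 [c2 [c3 [c4 [c5 [c6 [c7 [c8 [c9 ->]]]]]]]]]].
vm_compute; reflexivity.
Qed.

Lemma involutesE l m : size l = 10 -> size m = 10 ->
  involutes l m =
  [seq relabel (l ++ m) (relabelling p) | p <- perms6 & involution p].
Proof.
move=> /size10P[b0 [b1 [b2 [b3 [b4 [b5 [b6 [b7 [b8 [b9 ->]]]]]]]]]].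
move=> /size10P[c0 [c1 [c2 [c3 [c4 [c5 [c6 [c7 [c8 [c9 ->]]]]]]]]]].
vm_compute; reflexivity.
Qed.

(** An involution fixing the vertex 5 permutes the ten triples of the other five vertices, so the
    first ten bits of the relabelled pattern are determined by [l]. *)
Lemma prefix_involutesE l m : size l = 10 -> size m = 10 ->
  prefix_involutes l =
  [seq take 10 (relabel (l ++ m) (relabelling p))
  | p <- perms6 & involution p && (nth 0 p 5 == 5)].
Proof.
move=> /size10P[b0 [b1 [b2 [b3 [b4 [b5 [b6 [b7 [b8 [b9 ->]]]]]]]]]].
move=> /size10P[c0 [c1 [c2 [c3 [c4 [c5 [c6 [c7 [c8 [c9 ->]]]]]]]]]].
vm_compute; reflexivity.
Qed.

(* Some relabelling of a pattern is lexicographically maximal in the orbit; being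
   at least as large as its images under the involutions is a cheap necessary
   condition, also for the restriction to the first five vertices. *)
Fixpoint maximal (b : seq bool) (bs : seq (seq bool)) : bool :=
  if bs is c :: bs' then (if lexle c b then maximal b bs' else false) else true.

Lemma maximalE b bs : maximal b bs = all (lexle^~ b) bs.
Proof. by elim: bs => //= c bs ->; case: lexle. Qed.

(* Here and below, nested [if]s instead of [&&] and a test for zero before adding
   save evaluations that a strict strategy would perform. *)
Fixpoint all_bits (n : nat) (P : seq bool -> bool) : bool :=
  if n is n'.+1 then
    if all_bits n' (fun l => P (false :: l))
    then all_bits n' (fun l => P (true :: l)) else false
  else P [::].

Lemma all_bitsP n P l : all_bits n P -> size l = n -> P l.
Proof.
elim: n P l => [|n IH] P [|a l] //= PP [] /IH {}IH.
by move: PP; case: ifP => // /IH P0 /IH P1; case: a.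
Qed.

Fixpoint present (E b : seq bool) : bool :=
  match E, b with
  | e :: E', a :: b' =>
      if e then (if a then present E' b' else false) else present E' b'
  | _, _ => true
  end.

Fixpoint contains (E : seq bool) (bs : seq (seq bool)) : bool :=
  if bs is b :: bs' then (if present E b then true else contains E bs')
  else false.

Lemma containsE E bs : contains E bs = has (present E) bs.
Proof. by elim: bs => //= b bs ->; case: present. Qed.

Fixpoint orbit_sum (f : seq bool -> Z) (bs : seq (seq bool)) : Z :=
  if bs is b :: bs' then
    match f b with
    | Z0 => orbit_sum f bs'
    | z => (z + orbit_sum f bs')%Z
    end
  else 0%Z.

Definition evaluate (phi : seq (Z * (seq bool -> Z))) (b : seq bool) : Z :=
  (\sum_(cf <- phi) cf.1 * cf.2 b)%R.

Lemma orbit_sumE f bs : orbit_sum f bs = (\sum_(b <- bs) f b)%R.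
Proof.
elim: bs => [|b bs IH]; rewrite ?big_nil ?big_cons //= -IH.
by case: (f b) => //=; rewrite add0r.
Qed.

(** [bs] stands for the list of all relabellings of one pattern; therefore comparison with the
    single mask [E] detects the forbidden 3-graph under every labelling. *)
Definition nonneg_on_free (E : seq bool) (phi : seq (Z * (seq bool -> Z)))
    (bs : seq (seq bool)) : bool :=
  if contains E bs then true
  else Z.leb 0 (foldr (fun cf z => (cf.1 * orbit_sum cf.2 bs + z)%Z) 0%Z phi).

Lemma nonneg_on_freeP E phi bs : nonneg_on_free E phi bs ->
  (forall b, b \in bs -> ~~ present E b) ->
  (0 <= \sum_(b <- bs) evaluate phi b)%R.
Proof.
rewrite /nonneg_on_free containsE; case: ifP => [/hasP[b bin bE] _ /(_ b bin)|_ le _].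
  by rewrite bE.
suff -> : (\sum_(b <- bs) evaluate phi b)%R =
  foldr (fun cf z => (cf.1 * orbit_sum cf.2 bs + z)%Z) 0%Z phi by [].
rewrite /evaluate exchange_big /= {le}.
elim: phi => [|cf phi IH]; rewrite ?big_nil ?big_cons //= IH.
by rewrite orbit_sumE -mulr_sumr.
Qed.

Definition check_patterns (P : seq (seq bool) -> bool) : bool :=
  all_bits 10 (fun l =>
    if maximal l (prefix_involutes l) then
      all_bits 10 (fun m =>
        if maximal (l ++ m) (involutes l m) then P (relabellings l m) else true)
    else true).

(** A lexicographically maximal member of its orbit passes both filters, hence is reached by the
    enumeration. *)
Lemma check_patternsP P b : check_patterns P -> size b = 20 ->
  (forall p, p \in perms6 -> lexle (relabel b (relabelling p)) b) ->
  P [seq relabel b (relabelling p) | p <- perms6].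
Proof.
move=> PP sb mx; have [sl sm] : size (take 10 b) = 10 /\ size (drop 10 b) = 10.
  by rewrite size_take size_drop sb.
(* First filter: an inequality between whole patterns restricts to their prefixes of length ten. *)
have := all_bitsP PP sl; rewrite ifT; last first.
  rewrite maximalE (prefix_involutesE sl sm) cat_take_drop.
  apply/allP => c /mapP[p]; rewrite mem_filter => /andP[_ /mx le] ->.
  apply: (@lexle_cat _ (drop 10 (relabel b (relabelling p))) _ (drop 10 b)).
    by rewrite !size_take sb.
  by rewrite !cat_take_drop.
move/all_bitsP/(_ sm); rewrite ifT; first by rewrite relabellingsE // cat_take_drop.
rewrite maximalE involutesE // cat_take_drop.
by apply/allP => c /mapP[p]; rewrite mem_filter => /andP[_ /mx le] ->.
Qed.

(** * From checked patterns to sums over all 6-tuples *)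

Section Soundness.
Variables (V : finType) (h : V -> V -> V -> bool).
Hypothesis hC : forall a b c, h a b c = h b a c.
Hypothesis hCA : forall a b c, h a b c = h a c b.
Hypothesis hirr : forall a c, h a a c = false.
Variables (E : seq bool) (phi : seq (Z * (seq bool -> Z))).
Hypothesis checked : check_patterns (nonneg_on_free E phi).
Implicit Types (x : {ffun 'I_6 -> V}) (s : 'S_6).

Definition tuple_pattern x := pattern h (fun i => x (inord i)).
Definition act x s : {ffun 'I_6 -> V} := [ffun i => x (s i)].

Hypothesis free : forall x, ~~ present E (tuple_pattern x).

Lemma relabel_tuple_pattern x s :
  relabel (tuple_pattern x) (relabelling (perm_seq s)) = tuple_pattern (act x s).
Proof.
rewrite /tuple_pattern (relabel_pattern hC hCA hirr) ?size_perm_seq ?perm_seq_lt //.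
apply/eq_in_map => -[[i j] k] tin.
have [i6 j6 k6] : [/\ i < 6, j < 6 & k < 6].
  by move: tin; rewrite !inE => ijk; move: ijk; do ?[case/orP]; move=> /eqP[-> -> ->].
have nE q : q < 6 -> x (inord (nth 0 (perm_seq s) q)) = act x s (inord q).
  by move=> q6; rewrite ffunE -{1}(inordK q6) nth_perm_seq inord_val.
by rewrite /= !nE.
Qed.

Lemma actM x s t : act (act x s) t = act x (t * s)%g.
Proof. by apply/ffunP => i; rewrite !ffunE permM. Qed.

Lemma sum_orbit (F : seq bool -> Z) x :
  (\sum_(b <- [seq relabel (tuple_pattern x) (relabelling p) | p <- perms6]) F b =
   \sum_s F (tuple_pattern (act x s)))%R.
Proof.
rewrite big_map (perm_big _ perms6E) big_image.
by apply: eq_big => // s _; rewrite -relabel_tuple_pattern.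
Qed.

(** Replacing the tuple by one of its relabellings only translates the summation index in the group.
    The relabelling whose pattern is lexicographically maximal is covered by the check. *)
Lemma orbit_nonneg x : (0 <= \sum_s evaluate phi (tuple_pattern (act x s)))%R.
Proof.
pose s0 := [arg max_(s > 1%g) code (tuple_pattern (act x s))].
have mx s : code (tuple_pattern (act x s)) <= code (tuple_pattern (act x s0)).
  by rewrite /s0; case: arg_maxnP => // t _; exact.
rewrite (reindex_inj (mulIg s0)) /=.
under eq_bigr => s _ do rewrite -actM.
rewrite -sum_orbit; apply: (@nonneg_on_freeP E).
  apply: check_patternsP => // p; rewrite (perm_mem perms6E) => /mapP[s _ ->].
  rewrite relabel_tuple_pattern; apply: lexle_code => //.
  by rewrite actM.
move=> b /mapP[p]; rewrite (perm_mem perms6E) => /mapP[s _ ->] ->.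
by rewrite relabel_tuple_pattern.
Qed.

(** Each permutation acts bijectively on the 6-tuples, so the orbit inequalities add up to 6! times
    the desired sum. *)
Lemma sum_evaluate_nonneg : (0 <= \sum_x evaluate phi (tuple_pattern x))%R.
Proof.
have : (0 <= \sum_x \sum_s evaluate phi (tuple_pattern (act x s)))%R.
  by apply: sumr_ge0 => x _; exact: orbit_nonneg.
rewrite exchange_big /= (eq_bigr (fun=> \sum_x evaluate phi (tuple_pattern x))%R).
  rewrite sumr_const pmulrn_lge0 // card_Sn //.
move=> s _; rewrite [RHS](reindex_inj (h := act^~ s)) // => x y /ffunP xy.
by apply/ffunP => i; have := xy (s^-1%g i); rewrite !ffunE permKV.
Qed.
End Soundness.

(** * Sums of squares and multipliers *)

(** Tables indexed by bit strings, so that the check reads precomputed values by following the bits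
    of a pattern. *)
Inductive trie (A : Type) := Leaf of A | Node of trie A & trie A.

Fixpoint branch {A : Type} (n : nat) (f : seq bool -> trie A) : trie A :=
  if n is n'.+1 then
    Node (branch n' (fun l => f (false :: l))) (branch n' (fun l => f (true :: l)))
  else f [::].

(** Reading stops at a leaf: a table over the first 10 or 16 bits applies directly to a pattern of
    20 bits. *)
Fixpoint lookup {A : Type} (t : trie A) (d : A) (l : seq bool) : A :=
  match t, l with
  | Leaf a, _ => a
  | Node t0 t1, b :: l' => lookup (if b then t1 else t0) d l'
  | Node _ _, [::] => d
  end.

Lemma lookup_branch A n (f : seq bool -> trie A) d l : n <= size l ->
  lookup (branch n f) d l = lookup (f (take n l)) d (drop n l).
Proof.
elim: n f l => [|n IH] f [|b l] //= nl.
by case: b; rewrite IH.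
Qed.

Lemma lookup_leaf A (a d : A) l : lookup (Leaf a) d l = a.
Proof. by case: l. Qed.

Fixpoint dot (s t : seq Z) : Z :=
  match s, t with
  | a :: s', b :: t' => (a * b + dot s' t')%Z
  | _, _ => 0%Z
  end.

Lemma dotE n s t : size s <= n -> dot s t = (\sum_(k < n) s`_k * t`_k)%R.
Proof.
elim: s t n => [|a s IH] [|b t] [|n] // sn; rewrite ?big_ord0 //.
- by rewrite big1 // => i _; rewrite nth_nil mul0r.
- by rewrite big1 // => i _; rewrite nth_nil mul0r.
- by rewrite big1 // => i _; rewrite nth_nil mulr0.
- by rewrite big_ord_recl /= (IH t n).
Qed.

(** The double sum is the squared norm of the sum of the vectors [v x], the lists being padded with
    zeros to a common length. *)
Lemma sum_dot_nonneg (V : finType) (v : V -> seq Z) :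
  (0 <= \sum_x \sum_y dot (v x) (v y))%R.
Proof.
pose n := \max_x size (v x).
have vn x : size (v x) <= n by exact: leq_bigmax.
under eq_bigr => x _ do (under eq_bigr => y _ do rewrite (dotE _ (vn x))).
under eq_bigr => x _ do rewrite exchange_big.
rewrite exchange_big; apply: sumr_ge0 => k _ /=.
under eq_bigr => x _ do rewrite -mulr_sumr.
by rewrite -mulr_suml -expr2 sqr_ge0.
Qed.

Fixpoint coef (u : seq (Z * Z)) (p : Z) : Z :=
  if u is (k, c) :: u' then (if Z.eqb k p then c else coef u' p) else 0%Z.

(** Here the head is the least significant bit, unlike in [code]. *)
Fixpoint bits_Z (l : seq bool) : Z :=
  if l is b :: l' then (if b then Z.succ_double else Z.double) (bits_Z l')
  else 0%Z.

(* The representatives of the 3-graphs on four vertices, by number of edges. *)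
Definition type_index (t : seq bool) : nat :=
  match t with
  | [:: false; false; false; false] => 0
  | [:: true; false; false; false] => 1
  | [:: true; true; false; false] => 2
  | [:: true; true; true; false] => 3
  | [:: true; true; true; true] => 4
  | _ => 5
  end.

(* [U] lists, for each irreducible representation of the automorphism group of a
   type, vectors of one row of the isotypic component, supported on the flags [k];
   [L] lists the coefficients in these vectors of the linear forms squared. *)
Definition flag_vector (U : seq (seq (seq (Z * Z)))) (L : seq (seq (seq Z)))
    (p : seq bool) : seq Z :=
  let k := bits_Z p in
  flatten [seq (let a := [seq coef u k | u <- UL.1] in
                [seq dot r a | r <- UL.2]) | UL <- zip U L].

Definition gram_trie (v : seq bool -> seq Z) : trie Z :=
  let w := branch 6 (fun p => Leaf (v p)) in
  branch 6 (fun p => let x := lookup w [::] p in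
                     branch 6 (fun q => Leaf (dot x (lookup w [::] q)))).

(** For [Ls] of length at most five, one labelling of each type carries the squares; other
    labellings, and types beyond the end of [Ls], get zero. The list for K4^- stops at two edges,
    since a type with three or four edges contains K4^-. *)
Definition sos_trie (Us : seq (seq (seq (seq (Z * Z)))))
    (Ls : seq (seq (seq (seq Z)))) : trie Z :=
  branch 4 (fun t => if type_index t < size Ls then
      gram_trie (flag_vector (nth [::] Us (type_index t)) (nth [::] Ls (type_index t)))
    else Leaf 0%Z).

(** The four bits [r] belong to the triples containing both vertices 4 and 5. As the value ignores
    them, it depends on these two vertices only through one vector each. *)
Lemma sos_trie_gram Us Ls : exists W : seq bool -> seq bool -> seq Z,
  forall t p q r, size t = 4 -> size p = 6 -> size q = 6 ->
  lookup (sos_trie Us Ls) 0%Z (t ++ p ++ q ++ r) = dot (W t p) (W t q).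
Proof.
exists (fun t p => if type_index t < size Ls then
    flag_vector (nth [::] Us (type_index t)) (nth [::] Ls (type_index t)) p
  else [::]).
move=> t p q r st sp sq.
rewrite lookup_branch ?size_cat ?st // take_size_cat // drop_size_cat //.
case: (type_index t < size Ls); last by rewrite lookup_leaf.
rewrite /gram_trie lookup_branch ?size_cat ?sp // take_size_cat // drop_size_cat //.
rewrite lookup_branch ?size_cat ?sq // take_size_cat // lookup_leaf.
by rewrite !lookup_branch ?sp ?sq // !lookup_leaf -{1}sp -{1}sq !take_size.
Qed.

Definition unit_term (b : seq bool) : Z := 1%Z.
Definition edge_term (b : seq bool) : Z := if b is true :: _ then 1%Z else 0%Z.
(* The vertices 3, 4, 5 lie in the set of the [x] with [h 0 1 x], [~~ h 0 2 x] and
   [~~ h 1 2 x], for an edge [012]: this set is K4^- -free if [h] is [F42]-free. *)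
Definition cut_term (b : seq bool) : Z :=
  if b is [:: true; true; false; false; true; false; false; _; _; _;
              true; false; false; _; _; _; _; _; _; b345]
  then (if b345 then -699 else 301)%Z else 0%Z.
(** Bit 10 is the triple 015. With [c0 = - gamma] and [c1 = 1 - gamma] up to scale, summing over the
    vertex 5 turns the second factor into [degree - gamma * n] for the first two vertices. *)
Definition codegree_term (M : trie Z) (c0 c1 : Z) (b : seq bool) : Z :=
  match lookup M 0%Z b with
  | Z0 => 0%Z
  | z => (z * (if nth false b 10 then c1 else c0))%Z
  end.
(** The absolute value yields nonnegativity without an inspection of the table. *)
Definition multiplier (M : seq (Z * Z)) (l : seq bool) : Z :=
  Z.abs (coef M (bits_Z l)).
(* The entries 0, 1 and 4 are the triples that contain the vertices 0 and 1. *)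
Definition covered_multiplier (M : seq (Z * Z)) (l : seq bool) : Z :=
  if [|| nth false l 0, nth false l 1 | nth false l 4] then multiplier M l
  else 0%Z.

(** * Totals of the terms over all 6-tuples *)

Section Totals.
Local Open Scope ring_scope.
Variables (V : finType) (h : V -> V -> V -> bool).

Definition pattern6 (a b c d e f : V) : seq bool :=
  [:: h a b c; h a b d; h a c d; h b c d;
      h a b e; h a c e; h b c e; h a d e; h b d e; h c d e;
      h a b f; h a c f; h b c f; h a d f; h b d f; h c d f;
      h a e f; h b e f; h c e f; h d e f].

Definition total (F : seq bool -> Z) : Z :=
  \sum_a \sum_b \sum_c \sum_d \sum_e \sum_f F (pattern6 a b c d e f).

Definition triple_count : Z := \sum_a \sum_b \sum_c (h a b c)%:R.
Definition degree (a b : V) : Z := \sum_f (h a b f)%:R.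
Local Notation n := (#|V|%:R : Z).

Lemma sum_tuple_pattern (F : seq bool -> Z) :
  \sum_(x : {ffun 'I_6 -> V}) F (tuple_pattern h x) = total F.
Proof.
pose to (p : V * V * V * V * V * V) : {ffun 'I_6 -> V} :=
  [ffun i : 'I_6 => nth p.2 [:: p.1.1.1.1.1; p.1.1.1.1.2; p.1.1.1.2; p.1.1.2; p.1.2; p.2] i].
pose from (x : {ffun 'I_6 -> V}) :=
    (x (inord 0), x (inord 1), x (inord 2), x (inord 3), x (inord 4), x (inord 5)).
have to_bij : bijective to.
  exists from => [[[[[[a b] c] d] e] f]|x].
    by rewrite /from /to !ffunE !inordK.
  apply/ffunP => i; rewrite ffunE /from /=.
  by case: i => -[|[|[|[|[|[|i]]]]]] // i6 /=; congr (x _); apply: val_inj; rewrite /= inordK.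
rewrite (reindex to) /=; last exact: onW_bij.
rewrite /total !pair_bigA /=; apply: eq_bigr => -[[[[[a b] c] d] e] f] _.
by rewrite /tuple_pattern /pattern /= /to !ffunE !inordK.
Qed.

Lemma sum_cst (x : Z) : \sum_(a : V) x = n * x.
Proof. by rewrite sumr_const mulr_natl. Qed.

Lemma total_unit_term : total unit_term = n ^+ 6.
Proof. by rewrite /total /unit_term !sum_cst !exprS expr0. Qed.

Lemma total_edge_term : total edge_term = n ^+ 3 * triple_count.
Proof.
rewrite /total /triple_count mulr_sumr; apply: eq_bigr => a _.
rewrite mulr_sumr; apply: eq_bigr => b _; rewrite mulr_sumr; apply: eq_bigr => c _.
transitivity (\sum_(d : V) \sum_(e : V) \sum_(f : V) ((h a b c)%:R : Z)).
  by do 3!(apply: eq_bigr => ? _); rewrite /edge_term /=; case: (h a b c).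
by rewrite !sum_cst !exprS expr0 mulr1 !mulrA.
Qed.

(** For fixed first four vertices, the last two enter through the same vector-valued function, and
    the sum over them is a squared norm. *)
Lemma total_sos_nonneg Us Ls : 0 <= total (lookup (sos_trie Us Ls) 0%Z).
Proof.
have [W WE] := sos_trie_gram Us Ls.
apply: sumr_ge0 => a _; apply: sumr_ge0 => b _; apply: sumr_ge0 => c _.
apply: sumr_ge0 => d _.
pose p x := [:: h a b x; h a c x; h b c x; h a d x; h b d x; h c d x].
pose t := [:: h a b c; h a b d; h a c d; h b c d].
have := sum_dot_nonneg (fun e => W t (p e)); congr (_ <= _).
apply: eq_bigr => e _; apply: eq_bigr => f _.
by rewrite -(WE t (p e) (p f) [:: h a e f; h b e f; h c e f; h d e f]).
Qed.

(** Only the factor deciding the triple 015 varies with the sixth vertex. The last argument of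
    [pattern6], here [a], is a placeholder on which the first ten bits do not depend. *)
Lemma total_codegree_term m (c0 c1 : Z) :
  total (codegree_term (branch 10 (fun l => Leaf (m l))) c0 c1) =
  \sum_a \sum_b \sum_c \sum_d \sum_e
    m (take 10 (pattern6 a b c d e a)) * (c0 * n + (c1 - c0) * degree a b).
Proof.
do 5!(apply: eq_bigr => ? _); rewrite /degree !mulr_sumr mulrDr.
under eq_bigr => f _.
  have -> (M : trie Z) (b : seq bool) : codegree_term M c0 c1 b =
      lookup M 0%Z b * (c0 + (c1 - c0) * (nth false b 10)%:R).
    rewrite /codegree_term; case: (nth _ _ _); rewrite ?mulr0 ?addr0 ?mulr1 ?subrKC;
    by case: (lookup M 0%Z b) => //; rewrite mul0r.
  rewrite lookup_branch //= mulrDr.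
  over.
rewrite big_split /= sum_cst; congr (_ + _).
  by rewrite mulrC mulrA.
by rewrite mulr_sumr.
Qed.
End Totals.

Section Certified.
Local Open Scope ring_scope.
Variables (V : finType) (h : V -> V -> V -> bool).
Hypothesis hC : forall a b c, h a b c = h b a c.
Hypothesis hCA : forall a b c, h a b c = h a c b.
Hypothesis hirr : forall a c, h a a c = false.

Lemma certified_total E phi :
  check_patterns (nonneg_on_free E phi) ->
  (forall a b c d e f, ~~ present E (pattern6 h a b c d e f)) ->
  0 <= \sum_(cf <- phi) cf.1 * total h cf.2.
Proof.
move=> chk free.
have : 0 <= \sum_(x : {ffun 'I_6 -> V}) evaluate phi (tuple_pattern h x).
  by apply: (sum_evaluate_nonneg hC hCA hirr chk) => x; exact: free.
rewrite /evaluate exchange_big /=; congr (_ <= _); apply: eq_bigr => cf _.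
by rewrite -mulr_sumr sum_tuple_pattern.
Qed.
End Certified.

(** * The certificates *)

(* Found numerically by semidefinite programming and rounded; only the signs of the
   checked sums matter.  [flag_bases] comes from the Young symmetrizers of the
   automorphism groups of the five types; a flag is coded by the binary number of
   its six bits, a 5-vertex pattern by that of its ten bits. *)
Definition flag_bases : seq (seq (seq (seq (Z * Z)))) := (
  [:: [:: [:: [:: (0, 1)]; [:: (1, 1); (2, 1); (4, 1); (8, 1); (16, 1); (32, 1)]; [:: (3, 1); (5, 1);
  (6, 1); (9, 1); (10, 1); (17, 1); (20, 1); (24, 1); (34, 1); (36, 1); (40, 1); (48, 1)]; [:: (7, 1);
  (25, 1); (42, 1); (52, 1)]; [:: (11, 1); (21, 1); (38, 1); (56, 1)]; [:: (12, 1); (18, 1); (33, 1)];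
  [:: (13, 1); (14, 1); (19, 1); (22, 1); (26, 1); (28, 1); (35, 1); (37, 1); (41, 1); (44, 1); (49,
  1); (50, 1)]; [:: (15, 1); (23, 1); (27, 1); (29, 1); (39, 1); (43, 1); (46, 1); (53, 1); (54, 1);
  (57, 1); (58, 1); (60, 1)]; [:: (30, 1); (45, 1); (51, 1)]; [:: (31, 1); (47, 1); (55, 1); (59, 1);
  (61, 1); (62, 1)]; [:: (63, 1)]]; [:: [:: (1, 1); (2, 1); (4, 1); (8, -1); (16, -1); (32, -1)]; [::
  (3, 1); (5, 1); (6, 1); (24, -1); (40, -1); (48, -1)]; [:: (3, 2); (5, 2); (6, 2); (9, -1); (10,
  -1); (17, -1); (20, -1); (34, -1); (36, -1)]; [:: (7, 3); (25, -1); (42, -1); (52, -1)]; [:: (11,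
  1); (21, 1); (38, 1); (56, -3)]; [:: (13, 1); (14, 1); (19, 1); (22, 1); (26, -1); (28, -1); (35,
  1); (37, 1); (41, -1); (44, -1); (49, -1); (50, -1)]; [:: (15, 1); (23, 1); (39, 1); (57, -1); (58,
  -1); (60, -1)]; [:: (15, 2); (23, 2); (27, -1); (29, -1); (39, 2); (43, -1); (46, -1); (53, -1);
  (54, -1)]; [:: (31, 1); (47, 1); (55, 1); (59, -1); (61, -1); (62, -1)]]; [:: [:: (1, 2); (2, -1);
  (4, -1); (8, -1); (16, -1); (32, 2)]; [:: (3, 1); (5, 1); (6, -2); (9, 1); (10, -2); (17, 1); (20,
  -2); (24, -2); (34, 1); (36, 1); (40, 1); (48, 1)]; [:: (12, 1); (18, 1); (33, -2)]; [:: (13, 1);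
  (19, 1); (35, -1); (37, -1); (41, -1); (44, 1); (49, -1); (50, 1)]; [:: (14, 1); (22, 1); (26, 1);
  (28, 1); (35, -1); (37, -1); (41, -1); (49, -1)]; [:: (15, 1); (23, 1); (27, 1); (29, 1); (39, -2);
  (43, -2); (46, 1); (53, -2); (54, 1); (57, -2); (58, 1); (60, 1)]; [:: (30, 2); (45, -1); (51, -1)];
  [:: (31, 2); (47, -1); (55, -1); (59, -1); (61, -1); (62, 2)]]; [:: [:: (3, 1); (5, 1); (6, -2); (9,
  -1); (17, -1); (24, 2); (34, 1); (36, 1); (40, -1); (48, -1)]; [:: (14, 1); (22, 1); (26, -1); (28,
  -1); (35, -1); (37, -1); (41, 1); (49, 1)]; [:: (15, 1); (23, 1); (27, -1); (29, -1); (39, -2); (46,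
  1); (54, 1); (57, 2); (58, -1); (60, -1)]]; [:: [:: (13, 1); (14, -1); (19, -1); (22, 1); (26, 1);
  (28, -1); (35, 1); (37, -1); (41, -1); (44, 1); (49, 1); (50, -1)]]]; [:: [:: [:: (0, 1)]; [:: (1,
  1); (2, 1); (4, 1)]; [:: (3, 1); (5, 1); (6, 1)]; [:: (7, 1)]; [:: (8, 1); (16, 1); (32, 1)]; [::
  (9, 1); (10, 1); (17, 1); (20, 1); (34, 1); (36, 1)]; [:: (11, 1); (21, 1); (38, 1)]; [:: (12, 1);
  (18, 1); (33, 1)]; [:: (13, 1); (14, 1); (19, 1); (22, 1); (35, 1); (37, 1)]; [:: (15, 1); (23, 1);
  (39, 1)]; [:: (24, 1); (40, 1); (48, 1)]; [:: (25, 1); (42, 1); (52, 1)]; [:: (26, 1); (28, 1); (41,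
  1); (44, 1); (49, 1); (50, 1)]; [:: (27, 1); (29, 1); (43, 1); (46, 1); (53, 1); (54, 1)]; [:: (30,
  1); (45, 1); (51, 1)]; [:: (31, 1); (47, 1); (55, 1)]; [:: (56, 1)]; [:: (57, 1); (58, 1); (60, 1)];
  [:: (59, 1); (61, 1); (62, 1)]; [:: (63, 1)]]; [:: [:: (1, 2); (2, -1); (4, -1)]; [:: (3, 1); (5,
  1); (6, -2)]; [:: (8, 1); (16, 1); (32, -2)]; [:: (9, 1); (17, 1); (34, -1); (36, -1)]; [:: (10, 1);
  (20, 1); (34, -1); (36, -1)]; [:: (11, 1); (21, 1); (38, -2)]; [:: (12, 1); (18, 1); (33, -2)]; [::
  (13, 1); (19, 1); (35, -1); (37, -1)]; [:: (14, 1); (22, 1); (35, -1); (37, -1)]; [:: (15, 1); (23,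
  1); (39, -2)]; [:: (24, 2); (40, -1); (48, -1)]; [:: (25, 2); (42, -1); (52, -1)]; [:: (26, 1); (28,
  1); (44, -1); (50, -1)]; [:: (27, 1); (29, 1); (46, -1); (54, -1)]; [:: (26, 1); (28, 1); (41, -1);
  (49, -1)]; [:: (27, 1); (29, 1); (43, -1); (53, -1)]; [:: (30, 2); (45, -1); (51, -1)]; [:: (31, 2);
  (47, -1); (55, -1)]; [:: (57, 2); (58, -1); (60, -1)]; [:: (59, 1); (61, 1); (62, -2)]]; [:: [:: (9,
  1); (10, -1); (17, -1); (20, 1); (34, 1); (36, -1)]; [:: (13, 1); (14, -1); (19, -1); (22, 1); (35,
  1); (37, -1)]; [:: (26, 1); (28, -1); (41, -1); (44, 1); (49, 1); (50, -1)]; [:: (27, 1); (29, -1);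
  (43, -1); (46, 1); (53, 1); (54, -1)]]]; [:: [:: [:: (0, 1)]; [:: (1, 1)]; [:: (2, 1); (4, 1); (8,
  1); (16, 1)]; [:: (3, 1); (5, 1); (9, 1); (17, 1)]; [:: (6, 1); (24, 1)]; [:: (7, 1); (25, 1)]; [::
  (10, 1); (20, 1)]; [:: (11, 1); (21, 1)]; [:: (12, 1); (18, 1)]; [:: (13, 1); (19, 1)]; [:: (14, 1);
  (22, 1); (26, 1); (28, 1)]; [:: (15, 1); (23, 1); (27, 1); (29, 1)]; [:: (30, 1)]; [:: (31, 1)]; [::
  (32, 1)]; [:: (33, 1)]; [:: (34, 1); (36, 1); (40, 1); (48, 1)]; [:: (35, 1); (37, 1); (41, 1); (49,
  1)]; [:: (38, 1); (56, 1)]; [:: (39, 1); (57, 1)]; [:: (42, 1); (52, 1)]; [:: (43, 1); (53, 1)]; [::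
  (44, 1); (50, 1)]; [:: (45, 1); (51, 1)]; [:: (46, 1); (54, 1); (58, 1); (60, 1)]; [:: (47, 1); (55,
  1); (59, 1); (61, 1)]; [:: (62, 1)]; [:: (63, 1)]]; [:: [:: (2, 1); (4, 1); (8, -1); (16, -1)]; [::
  (3, 1); (5, 1); (9, -1); (17, -1)]; [:: (6, 1); (24, -1)]; [:: (7, 1); (25, -1)]; [:: (14, 1); (22,
  1); (26, -1); (28, -1)]; [:: (15, 1); (23, 1); (27, -1); (29, -1)]; [:: (34, 1); (36, 1); (40, -1);
  (48, -1)]; [:: (35, 1); (37, 1); (41, -1); (49, -1)]; [:: (38, 1); (56, -1)]; [:: (39, 1); (57,
  -1)]; [:: (46, 1); (54, 1); (58, -1); (60, -1)]; [:: (47, 1); (55, 1); (59, -1); (61, -1)]]; [:: [::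
  (2, 1); (4, -1); (8, 1); (16, -1)]; [:: (3, 1); (5, -1); (9, 1); (17, -1)]; [:: (10, 1); (20, -1)];
  [:: (11, 1); (21, -1)]; [:: (14, 1); (22, -1); (26, 1); (28, -1)]; [:: (15, 1); (23, -1); (27, 1);
  (29, -1)]; [:: (34, 1); (36, -1); (40, 1); (48, -1)]; [:: (35, 1); (37, -1); (41, 1); (49, -1)]; [::
  (42, 1); (52, -1)]; [:: (43, 1); (53, -1)]; [:: (46, 1); (54, -1); (58, 1); (60, -1)]; [:: (47, 1);
  (55, -1); (59, 1); (61, -1)]]; [:: [:: (2, 1); (4, -1); (8, -1); (16, 1)]; [:: (3, 1); (5, -1); (9,
  -1); (17, 1)]; [:: (12, 1); (18, -1)]; [:: (13, 1); (19, -1)]; [:: (14, 1); (22, -1); (26, -1); (28,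
  1)]; [:: (15, 1); (23, -1); (27, -1); (29, 1)]; [:: (34, 1); (36, -1); (40, -1); (48, 1)]; [:: (35,
  1); (37, -1); (41, -1); (49, 1)]; [:: (44, 1); (50, -1)]; [:: (45, 1); (51, -1)]; [:: (46, 1); (54,
  -1); (58, -1); (60, 1)]; [:: (47, 1); (55, -1); (59, -1); (61, 1)]]]; [:: [:: [:: (0, 1)]; [:: (1,
  1); (2, 1); (8, 1)]; [:: (3, 1); (9, 1); (10, 1)]; [:: (4, 1); (16, 1); (32, 1)]; [:: (5, 1); (6,
  1); (17, 1); (24, 1); (34, 1); (40, 1)]; [:: (7, 1); (25, 1); (42, 1)]; [:: (11, 1)]; [:: (12, 1);
  (18, 1); (33, 1)]; [:: (13, 1); (14, 1); (19, 1); (26, 1); (35, 1); (41, 1)]; [:: (15, 1); (27, 1);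
  (43, 1)]; [:: (20, 1); (36, 1); (48, 1)]; [:: (21, 1); (38, 1); (56, 1)]; [:: (22, 1); (28, 1); (37,
  1); (44, 1); (49, 1); (50, 1)]; [:: (23, 1); (29, 1); (39, 1); (46, 1); (57, 1); (58, 1)]; [:: (30,
  1); (45, 1); (51, 1)]; [:: (31, 1); (47, 1); (59, 1)]; [:: (52, 1)]; [:: (53, 1); (54, 1); (60, 1)];
  [:: (55, 1); (61, 1); (62, 1)]; [:: (63, 1)]]; [:: [:: (1, 1); (2, 1); (8, -2)]; [:: (3, 2); (9,
  -1); (10, -1)]; [:: (4, 2); (16, -1); (32, -1)]; [:: (5, 1); (6, 1); (24, -1); (40, -1)]; [:: (5,
  1); (6, 1); (17, -1); (34, -1)]; [:: (7, 2); (25, -1); (42, -1)]; [:: (12, 2); (18, -1); (33, -1)];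
  [:: (13, 1); (14, 1); (26, -1); (41, -1)]; [:: (13, 1); (14, 1); (19, -1); (35, -1)]; [:: (15, 2);
  (27, -1); (43, -1)]; [:: (20, 1); (36, 1); (48, -2)]; [:: (21, 1); (38, 1); (56, -2)]; [:: (22, 1);
  (37, 1); (49, -1); (50, -1)]; [:: (23, 1); (39, 1); (57, -1); (58, -1)]; [:: (28, 1); (44, 1); (49,
  -1); (50, -1)]; [:: (29, 1); (46, 1); (57, -1); (58, -1)]; [:: (30, 1); (45, 1); (51, -2)]; [:: (31,
  1); (47, 1); (59, -2)]; [:: (53, 1); (54, 1); (60, -2)]; [:: (55, 2); (61, -1); (62, -1)]]; [:: [::
  (5, 1); (6, -1); (17, -1); (24, 1); (34, 1); (40, -1)]; [:: (13, 1); (14, -1); (19, -1); (26, 1);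
  (35, 1); (41, -1)]; [:: (22, 1); (28, -1); (37, -1); (44, 1); (49, 1); (50, -1)]; [:: (23, 1); (29,
  -1); (39, -1); (46, 1); (57, 1); (58, -1)]]]; [:: [:: [:: (0, 1)]; [:: (1, 1); (2, 1); (4, 1); (8,
  1); (16, 1); (32, 1)]; [:: (3, 1); (5, 1); (6, 1); (9, 1); (10, 1); (17, 1); (20, 1); (24, 1); (34,
  1); (36, 1); (40, 1); (48, 1)]; [:: (7, 1); (25, 1); (42, 1); (52, 1)]; [:: (11, 1); (21, 1); (38,
  1); (56, 1)]; [:: (12, 1); (18, 1); (33, 1)]; [:: (13, 1); (14, 1); (19, 1); (22, 1); (26, 1); (28,
  1); (35, 1); (37, 1); (41, 1); (44, 1); (49, 1); (50, 1)]; [:: (15, 1); (23, 1); (27, 1); (29, 1);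
  (39, 1); (43, 1); (46, 1); (53, 1); (54, 1); (57, 1); (58, 1); (60, 1)]; [:: (30, 1); (45, 1); (51,
  1)]; [:: (31, 1); (47, 1); (55, 1); (59, 1); (61, 1); (62, 1)]; [:: (63, 1)]]; [:: [:: (1, 1); (2,
  1); (4, 1); (8, -1); (16, -1); (32, -1)]; [:: (3, 1); (5, 1); (6, 1); (24, -1); (40, -1); (48, -1)];
  [:: (3, 2); (5, 2); (6, 2); (9, -1); (10, -1); (17, -1); (20, -1); (34, -1); (36, -1)]; [:: (7, 3);
  (25, -1); (42, -1); (52, -1)]; [:: (11, 1); (21, 1); (38, 1); (56, -3)]; [:: (13, 1); (14, 1); (19,
  1); (22, 1); (26, -1); (28, -1); (35, 1); (37, 1); (41, -1); (44, -1); (49, -1); (50, -1)]; [:: (15,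
  1); (23, 1); (39, 1); (57, -1); (58, -1); (60, -1)]; [:: (15, 2); (23, 2); (27, -1); (29, -1); (39,
  2); (43, -1); (46, -1); (53, -1); (54, -1)]; [:: (31, 1); (47, 1); (55, 1); (59, -1); (61, -1); (62,
  -1)]]; [:: [:: (1, 2); (2, -1); (4, -1); (8, -1); (16, -1); (32, 2)]; [:: (3, 1); (5, 1); (6, -2);
  (9, 1); (10, -2); (17, 1); (20, -2); (24, -2); (34, 1); (36, 1); (40, 1); (48, 1)]; [:: (12, 1);
  (18, 1); (33, -2)]; [:: (13, 1); (19, 1); (35, -1); (37, -1); (41, -1); (44, 1); (49, -1); (50, 1)];
  [:: (14, 1); (22, 1); (26, 1); (28, 1); (35, -1); (37, -1); (41, -1); (49, -1)]; [:: (15, 1); (23,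
  1); (27, 1); (29, 1); (39, -2); (43, -2); (46, 1); (53, -2); (54, 1); (57, -2); (58, 1); (60, 1)];
  [:: (30, 2); (45, -1); (51, -1)]; [:: (31, 2); (47, -1); (55, -1); (59, -1); (61, -1); (62, 2)]];
  [:: [:: (3, 1); (5, 1); (6, -2); (9, -1); (17, -1); (24, 2); (34, 1); (36, 1); (40, -1); (48, -1)];
  [:: (14, 1); (22, 1); (26, -1); (28, -1); (35, -1); (37, -1); (41, 1); (49, 1)]; [:: (15, 1); (23,
  1); (27, -1); (29, -1); (39, -2); (46, 1); (54, 1); (57, 2); (58, -1); (60, -1)]]; [:: [:: (13, 1);
  (14, -1); (19, -1); (22, 1); (26, 1); (28, -1); (35, 1); (37, -1); (41, -1); (44, 1); (49, 1); (50,
  -1)]]]])%Z.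

Definition K4m_factors : seq (seq (seq (seq Z))) := (
  [:: [:: [:: [:: 0; 2]; [:: 0; 0; 0; 0; 0; 384]; [:: 61; -328; -24; 0; -79; -491; 239]; [:: -267;
  -362; 457; 0; -72; 311; 342; 0; 942]]; [:: [:: 0; 1]; [:: 0; -2; 1]; [:: 7; 3; 1]; [:: 582; 374; 30;
  0; 19; 101]]; [:: [:: 0; 0; 414]; [:: 0; 0; -5; 1]; [:: 0; 0; 2; -1; 2]; [:: -299; -281; 193; -231;
  608; 0; 20]]; [:: [:: 3]; [:: 389; 272]]; [:: [:: 1]]]; [:: [:: [:: 0; 1]; [:: 0; 0; 0; 0; 391]; [::
  0; -2; 0; 0; -23; 3]; [:: 0; -1; 0; 0; 6; 1; 0; 9]; [:: -1; 27; 0; 0; 507; -34; 0; -479; 0; 0; 497];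
  [:: 4; -77; 0; 0; -37; -208; 0; -163; 0; 0; 221; 0; 310]; [:: -167; -637; 0; 0; 357; -138; 0; 1283;
  0; 0; 1383; 0; 917; 0; 0; 0; 385]]; [:: [:: 1]; [:: 0; 0; 469]; [:: 0; 0; 3; 5]; [:: -7; 0; -6; -15;
  12]; [:: 13; 0; 6; 15; -20; 0; 18]; [:: 715; 0; 126; 1099; -1112; 0; 766; 0; 0; 0; 672]; [:: 221; 0;
  1299; 621; 829; 0; 879; 0; 0; 0; 895; 0; 1257]; [:: -197; 0; 439; -752; 153; 0; 1487; 0; 0; 0; -142;
  0; -403; 0; 968]]; [:: [:: 4]; [:: 414; 0; 384]]]; [:: [:: [:: 1]; [:: 0; 0; 1]; [:: 0; 0; -1; 0; 0;
  0; 0; 0; 2]; [:: -1; 0; 0; 0; 0; 0; 0; 0; 0; 0; 0; 0; 0; 0; 50]; [:: 0; 0; -1; 0; 0; 0; 0; 0; -2; 0;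
  0; 0; 0; 0; 14; 8]; [:: 22; -53; -65; 0; 0; 0; 53; 0; 387; 0; 0; 0; 0; 0; -32; -1614; 658]; [:: 32;
  -428; 156; 0; 0; 0; 194; 0; -56; 0; 0; 0; 0; 0; -2018; 787; -430; 0; 0; 0; 0; 0; 235]]; [:: [:: 3];
  [:: 0; 0; 0; 0; 0; 0; 4]]; [:: [:: 2]; [:: 1; 0; 3]; [:: 997; 0; 1249; 0; 0; 0; 1110]]; [:: [:: 2];
  [:: 1; 0; 5]; [:: 2; 0; -2; 0; 0; 0; 5]; [:: -764; 0; 1297; 0; 0; 0; -1129; 0; 596]]]])%Z.

Definition F42_factors : seq (seq (seq (seq Z))) := (
  [:: [:: [:: [:: 0; 1]; [:: -1; 1; 3]; [:: 0; 0; 0; 250]; [:: -2; 4; -3; 11; 1]; [:: -1; 1; 0; 3; 0;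
  9]; [:: 0; 0; 0; -2; 0; 0; 298]; [:: 0; 0; 0; -25; 0; 0; -79; 75]; [:: -2; -4; 2; 22; 1; 3; 49; 0;
  2]; [:: -1; -7; 4; -1; 0; 2; 19; -3; 2; 7]; [:: -10652; -10782; -9413; -6210; 6920; -9197; -4441;
  7083; 7147; 10024; 18750]]; [:: [:: 6]; [:: 0; 2]; [:: 1; -10; 5]; [:: 0; 0; 0; 194]; [:: 1; 7; 0;
  2]; [:: 0; -1; 0; 9; 0; 430]; [:: 0; 0; 0; 4; 0; 19; 161]; [:: 0; 2; -1; 29; 0; 196; -141; 134]; [::
  6191; -962; 477; 1364; -5; 5602; -3414; 1152; 3895]]; [:: [:: 1]; [:: 0; 4]; [:: 0; 0; 96]; [:: 0;
  0; -1; 506]; [:: 0; 0; 14; -220; 472]; [:: 0; 0; -2; 189; -70; 54]; [:: -6; -5; -5; -3; 5; 5; 1];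
  [:: -4377; -3995; -3205; -7720; 10838; 3789; 924; 2167]]; [:: [:: 153]; [:: -14; 452]; [:: 4518;
  -1715; 2988]]; [:: [:: 395]]]; [:: [:: [:: 2]; [:: -13; 13]; [:: 0; 0; 239]; [:: 0; 0; -37; 406];
  [:: 79; -81; 6; 18; 50]; [:: 13; -13; -6; 24; 8; 442]; [:: 16; -16; -150; 50; 10; -9; 168]; [:: 35;
  -35; -19; 23; 21; 23; 13; 93]; [:: -5; 5; -13; 11; -3; -22; 1; -1; 3134]; [:: 28; -28; -74; 58; 17;
  -14; 44; 1; -34; 352]; [:: 68; -70; -81; -242; 41; -24; -14; 23; -47; 53; 166]; [:: -2; 2; -7; 1;
  -1; 0; 2; 0; -1265; -2; 1; 6482]; [:: 41; -42; -309; -161; 24; -43; 76; -32; -91; 17; 83; 275; 183];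
  [:: 49; -51; -199; -177; 30; -273; -24; -9; -52; -205; 120; 493; 83; 275]; [:: 140; -143; -1075;
  -1809; 82; -587; -225; -27; -112; -733; 491; 404; 263; 509; 589]; [:: 70; -71; 673; 124; 44; -134;
  -575; -3; -158; -628; 8; -12; -187; 310; -81; 445]; [:: -4430; 409; 15208; 9768; 1466; 386; -4835;
  2031; 2003; -3082; -1584; -197; -5341; 125; -4976; 4006; 1360]; [:: -45; -1832; 56; -14695; 1848;
  -8303; -9614; 193; -965; -15429; 5127; 9267; -1018; 9439; 3566; 5360; 620; 6604]; [:: 7055; -9839;
  -1461; -6985; 7017; -4782; -2612; 888; -3834; 2063; 6645; -2464; -1086; 3068; -26; 3410; 868; 5128;
  6479]; [:: -11733; -22090; 10070; 12999; -16579; -14730; -1914; -12376; 14161; 13749; -15360; -7052;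
  -12761; -1503; 9484; 12429; 11253; 18107; 30167; 33515]]; [:: [:: 182]; [:: 52; 185]; [:: 149; 41;
  74]; [:: 24; -3; 3; 1277]; [:: -18; -9; 3; -422; 752]; [:: 355; -180; 51; 148; -113; 326]; [:: -90;
  8; 10; -91; 136; -61; 140]; [:: 2; 3; 0; 90; -1; -1; 1; 5311]; [:: 10; -6; 3; 226; 54; 13; 7; -1122;
  7048]; [:: 258; -88; 35; -377; -176; 187; -1; -106; -475; 253]; [:: 11; -35; 63; 420; 267; 106; 56;
  -122; 418; 17; 130]; [:: 28; -3; 3; 50; -24; 15; -10; 933; 465; 13; 0; 5804]; [:: -43; 82; 88; 412;
  319; 0; 167; 109; -94; -62; 96; 472; 277]; [:: 107; -74; 0; 41; -475; 143; -21; 137; -818; 45; 4;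
  465; 10; 620]; [:: -924; 41; 269; -703; 1855; -293; 614; -295; -28; -123; 389; -352; -35; -168;
  1464]; [:: 8147; 2466; -3237; 7067; -24300; 429; -6452; 5089; -4898; -1518; -4568; 5481; 2050; 1615;
  -17047; 6627]; [:: -7076; 8593; -1685; 8612; -8517; -3731; -1947; 3868; -638; -1838; -436; 1085;
  1845; 8271; -9560; 3207; 4618]; [:: -2153; 3009; 1406; 6685; -6680; 268; 2164; 4698; -5942; 15650;
  4273; 9074; -1313; 17272; -1385; -11562; 650; 12298]; [:: 4349; -2906; 7134; 12374; 2231; 17356;
  8176; 7754; 7238; 11025; 8196; 16705; 5300; 22776; 8570; -9645; 5589; -881; 19413]; [:: -2415;
  -6924; -662; -3726; 3757; 9093; -6213; -7321; 2399; 16911; 3271; -5374; -10722; 15317; 5400; -33723;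
  3525; 942; 2644; 3853]]; [:: [:: 862]; [:: -113; 7718]; [:: 791; 1360; 1137]; [:: 8058; 4879; 7922;
  1773]]]; [:: [:: [:: 2]; [:: 0; 1]; [:: 0; 0; 596]; [:: 0; 0; -74; 135]; [:: 0; 0; 7; -1; 7774]; [::
  0; 0; 29; -11; -236; 340]; [:: 0; -3; -4; -1; -72; -6; 1]; [:: 0; 1; 43; -9; 201; 25; 0; 7]; [:: 0;
  0; 27; -37; 219; -17; 0; 0; 296]; [:: 0; 0; -69; -14; 211; -8; 0; 0; -24; 334]; [:: 0; 0; 8; -19;
  402; -20; 0; 1; -86; -103; 138]; [:: 0; 0; 25; -16; -87; 75; 0; 0; 85; 136; -188; 229]; [:: 0; -5;
  -3; 6; -243; -23; 2; -2; 16; 18; -23; 16; 4]; [:: 1; 0; -4; 4; -35; 14; -9; 3; 12; 11; -19; 17; -1;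
  9]; [:: 0; 0; -23; 12; -126; -38; 0; 0; -77; -7; 13; -10; 0; 1; 196]; [:: 0; 43; -61; 21; 336; 59;
  -45; -6; -75; -7; -39; 21; -27; 15; 33; 96]; [:: 0; 4; -267; -22; 95; 23; -4; 0; 13; -16; 2; -51;
  -2; 1; 6; 9; 210]; [:: 0; 2; -75; 19; -15; -84; -1; 0; -95; -159; 87; -117; -1; 0; 15; 4; 16; 467];
  [:: 0; 3; -288; 18; -914; -213; -2; 0; -130; -50; 77; -114; -2; 0; 9; 6; 65; 179; 1212]; [:: 0; -2;
  125; -13; 225; 23; 3; 1; -9; -27; 51; -27; 2; -1; -17; -6; -22; 86; -473; 285]; [:: 0; -7; -135; 4;
  -147; -37; 8; 0; -9; -153; 68; -69; 5; -3; -3; -16; 20; -33; 74; -19; 246]; [:: 0; 17; 51; -27;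
  -410; -89; -18; -3; -83; -14; 85; -139; -11; 6; 1; 38; -36; 166; 61; 26; -69; 157]; [:: 1; 91; -285;
  -40; -614; -69; -214; 1; -294; -148; 20; -265; -71; 141; 266; 270; 99; 120; 361; -227; -93; 263;
  123]; [:: -2; -169; 376; -117; 447; -361; 398; -1; 537; -89; 223; 11; 132; -262; -655; -502; -36;
  224; 334; 419; 151; -356; -227; 689]; [:: 1; 55; -199; -1; 111; -13; -137; 2; -256; -34; 7; -156;
  -44; 92; 242; 167; 52; -97; 208; -209; -57; 143; 83; -246; 138]; [:: -43; -4334; 4288; -4001; 2762;
  -13195; 10336; -63; 11800; -9073; 11367; -6051; 3411; -6826; -17273; -12950; -2701; 11777; 13510;
  10549; 4975; -7378; -5977; 20124; -1394; 3137]; [:: 34; -17473; 6628; 622; -10062; -1439; 11981;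
  3504; -2174; 5855; 4893; 9020; 10136; -424; -65; -35415; 8632; -31656; 5166; -1135; 19486; -20556;
  5551; -24297; 14297; -5878; 12129]; [:: 3485; -25723; -20925; -12053; -8985; 7584; -21847; 10107;
  -9312; 18146; -7389; 13519; 10096; 35441; -28819; -29972; -18081; -5943; -12909; 11493; -2641;
  38644; -2441; 21711; 16543; 40459; 36707; 45847]]; [:: [:: 1305]; [:: 1022; 231]; [:: 5; -3; 11189];
  [:: 350; 10; 2; 683]; [:: -125; -26; -32; 91; 171]; [:: 242; 65; -172; 183; 220; 235]; [:: 2576;
  497; 1281; 736; 688; 773; 948]; [:: 10148; 2203; 8711; -373; 4093; 4396; 4393; 6546]; [:: 3718; 562;
  2363; 240; 751; 860; 940; 990; 1282]; [:: -15905; -3170; -11793; 675; -5248; -5724; -6038; -8316;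
  -1787; 1208]; [:: -11648; -6995; -8109; -35463; -16099; -10514; -6773; -12887; 19182; -35930; 8949];
  [:: 6207; -26057; -5611; -20420; -17587; -12656; 3190; -10377; 9273; 25148; 10633; 26386]]; [:: [::
  773]; [:: 92; 354]; [:: 21; 80; 39]; [:: 53; 96; 79; 15]; [:: 305; -92; -11; -2; 217]; [:: -152;
  -379; -57; -8; 157; 269]; [:: 703; 812; 90; 13; -118; -71; 409]; [:: 159; 627; 102; 15; -147; -186;
  160; 585]; [:: -55; 571; 83; 12; -126; -146; 158; 345; 301]; [:: 123; 14171; 8681; 1296; -3292;
  -6018; 6755; 15552; 8617; 8945]; [:: -18723; -12345; -5769; -850; -980; 7526; -1108; -818; 769;
  -3840; 11957]; [:: 12484; -8099; 23183; 3530; 11537; 863; 13607; 6871; 11961; 29528; -22433; 7260]];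
  [:: [:: 711]; [:: -2; 259]; [:: -85; -109; 433]; [:: -90; -4; -27; 355]; [:: -53; -218; 277; -3;
  267]; [:: 25; 118; -82; -37; -70; 162]; [:: 146; -156; 25; 45; -69; -128; 349]; [:: -12; 40; -25;
  103; -73; 6; 13; 609]; [:: 77; 265; -115; 96; -179; 68; -133; 372; 118]; [:: 375; 18793; -12584;
  -5550; -4832; 3231; -7464; 1044; 1206; 10894]; [:: 16767; 9598; -19842; -18; -17150; -4465; 10746;
  12694; 317; 6077; 11257]; [:: 6309; -8318; 1241; -12731; -5590; 8901; -15886; 16627; -8959; 594;
  23952; 27073]]]; [:: [:: [:: 596]; [:: -311; 251]; [:: 24; -5; 4]; [:: -33; 7; 0; 6945]; [:: -70;
  24; 0; -670; 168]; [:: 56; -19; 0; -622; -73; 147]; [:: -62; 2; 0; 402; 7; -24; 2]; [:: -165; 99; 0;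
  -245; -31; -170; 0; 748]; [:: -7; 41; 0; 855; -36; -163; 0; 292; 119]; [:: 56; -4; 0; -402; -6; 29;
  -3; -2; -2; 7]; [:: -343; 11; 0; 160; -32; -58; 0; -105; 23; 1; 181]; [:: 264; -89; 0; 297; 27; 27;
  0; -113; -26; 0; -78; 151]; [:: -702; 222; -1; 294; -61; -572; 1; 1203; 121; -2; 161; -134; 152];
  [:: 390; -255; 0; -37; -24; 23; 0; 9; -23; -1; -29; 11; -41; 105]; [:: -197; 24; -1; -257; 8; 5; -2;
  0; -9; 2; 22; -31; 7; -19; 36]; [:: 1442; -1288; -1576; -1011; -836; 568; -643; -1224; 1135; 892;
  -665; -539; 341; 669; 3733; 1837]; [:: 7252; -6424; -13463; -9733; -9451; -5026; -9736; 6939; 15241;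
  3363; 4866; -755; 4634; 2411; 31071; 11868; 7869]; [:: 2861; 3671; 818; 11635; -585; -11589; -4384;
  16210; -3795; -6412; 13498; 10931; 1152; -2480; -11963; -5882; 9727; 4210]; [:: 16038; -10495;
  -15812; 5888; -9637; -12823; -16588; -17104; -5406; -4951; 24845; 24540; 3443; 4232; 7114; 7215;
  21798; 13029; 52565]; [:: -13898; -17721; -25923; -15371; -11120; -11547; -766; 8355; 2366; 22602;
  -21397; -15822; 8497; 21683; 49293; 37999; -16707; 6120; 60537; 65364]]; [:: [:: 171]; [:: 32; 22];
  [:: 14; 0; 9122]; [:: -13; 1; -41; 349]; [:: -34; 0; 1094; -335; 349]; [:: 58; 3; 40; 175; -104;
  123]; [:: 0; -1; -501; 10; -3; -6; 414]; [:: -30; 3; -68; 45; 30; 41; -30; 123]; [:: 1; 0; -3; -54;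
  31; -28; -31; -69; 185]; [:: -14; 2; 71; -54; 74; -9; -36; -4; 84; 45]; [:: -153; 0; 478; -15; 22;
  -8; 11; 29; 17; 19; 160]; [:: 61; -2; -211; 4; 0; 16; 22; -71; 42; -2; -78; 106]; [:: 22; 5; -45; 3;
  9; 9; 70; 40; -39; 0; 17; -41; 164]; [:: 171; 0; -545; 48; -105; -5; -141; -52; 2; -6; -66; -12;
  -56; 170]; [:: -295; 1; 232; -188; 190; -116; 164; 60; 94; 23; 154; -42; -128; -183; 325]; [:: -321;
  3; 615; -290; 137; -230; 317; -88; 426; 56; 132; 6; -510; -562; 604; 384]; [:: 5784; 11883; -2457;
  3194; 4719; -425; 8816; 1980; 36028; 8622; 3814; -3613; -26489; -31469; 38574; 30458; 11203]; [::
  348; -10761; -4975; -20127; -10734; -18926; 5033; -23347; 20152; 1164; -4228; 7889; -32418; -5610;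
  20007; 14484; -9189; 9422]; [:: -12812; 543; -3368; -3570; -622; -7328; -31; -53569; 6943; -20672;
  3888; 1580; 2580; -28258; -19062; -20571; -24940; -23056; 12566]; [:: 3817; -3590; -4319; 8244;
  -10065; 57; -28185; -25226; -22315; -15364; -3817; -151; 28580; 14441; -38091; -32573; -16180;
  -12062; 6305; 39775]]; [:: [:: 11027]; [:: 12798; 286]; [:: 11647; 3419; 4325]; [:: -8627; -8606;
  27166; 33353]]]; [:: [:: [:: 258]; [:: -3; 498]; [:: -51; -362; 95]; [:: 0; -1]; [:: -1; -19; -2; 0;
  3]; [:: 3; 23; -7; 0; 0; 186]; [:: 18; 151; -35; 0; 0; 5; 45]; [:: 4; -18; -3; 0; -2; -4; -2; 3];
  [:: -102; -50; -59; 0; 0; 7; 12; 0; 2170]; [:: 38; -122; 21; 0; 0; -3; -7; 0; -819; 373]; [:: -5579;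
  -10774; -10657; -12148; -4976; 8165; 10478; 22582; 45003; 41728; 48592]]; [:: [:: 676]; [:: 4; 177];
  [:: 2615; 5; 496]; [:: 66; 4; 12; 2]; [:: -526; 87; -76; 27; 25]; [:: -7124; 108; -1336; 20; 19;
  151]; [:: 5924; -86; 1095; -20; -19; -111; 6]; [:: -8813; -6469; -5103; -6435; -5956; 3965; 34;
  10813]; [:: 4127; -6047; -6018; -6052; -5604; 3817; 40; 10109; 22497]]; [:: [:: 348]; [:: 387; 116];
  [:: -49; -14; 132]; [:: 111; 32; -4; 71]; [:: 23; 6; -1; -8; 95]; [:: -51; -80; 334; 315; 319; 343];
  [:: 4060; 1889; 125; 669; 448; 383; 19673]; [:: 2108; -966; 25785; 26279; 26614; 27027; 30663;
  19047]]; [:: [:: 917]; [:: -1376; 180]; [:: 10369; -474; 552]]; [:: [:: 4514]]]])%Z.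

Definition F42_codegree_factors : seq (seq (seq (seq Z))) := (
  [:: [:: [:: [:: 1]; [:: -1; 2]; [:: 0; -5; 3]; [:: 0; -2; 1; 5]; [:: -2; -1; -1; 0; 2]; [:: 2; 3; 0;
  -6; -2; 30]; [:: 1; -5; 1; 2; -1; -14; 6]; [:: 6; 43; -17; -58; -11; 158; 10; 30]; [:: 8; 53; -22;
  -60; -22; 170; 19; 36; 23]; [:: -7; -1720; -51; 2265; -2891; -934; 2455; 912; 6920; 2529]; [:: -522;
  409; 390; -829; 3203; -2586; -2644; -1371; -6668; -2037; 540]]; [:: [:: 3]; [:: 5; 4]; [:: 1; -7;
  4]; [:: -3; 4; -3; 4]; [:: 4; 4; 0; 4; 2]; [:: -3; 161; -69; 103; 29; 96]; [:: -1170; -623; 204;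
  -377; 480; 103; 3000]; [:: 3196; -796; 759; -1244; -1282; -1863; -6164; 606]; [:: -2871; -7642;
  3236; -1489; -296; -1923; 5356; -3381; 2057]]; [:: [:: 2]; [:: 1; 2]; [:: 0; 0; 11]; [:: 0; -1; -3;
  7]; [:: 1; 0; -4; -7; 13]; [:: 2; 0; -3; -1; 4; 3]; [:: -71; -170; 247; 183; 427; 176; 325]; [::
  655; 2003; -2714; -2251; -5179; -2139; -3835; 287]]; [:: [:: 6]; [:: 10; 15]; [:: 2257; 1730; 909]];
  [:: [:: 3515]]]; [:: [:: [:: 5]; [:: 0; 2]; [:: -1; -1; 4]; [:: -1; -1; -2; 8]; [:: 0; -1; -4; 5;
  19]; [:: 0; -1; -1; 1; -6; 5]; [:: -2; -1; -4; 0; 0; 0; 9]; [:: -1; -1; -6; -7; 13; -1; 1; 9]; [::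
  -2; 1; 1; 8; -2; -6; -2; -3; 18]; [:: -7; 0; 5; -10; -14; -5; 4; -2; 4; 25]; [:: -5; 3; -4; -10; -3;
  -3; -4; -3; 3; -4; 14]; [:: 1; 1; -7; 9; -1; 5; 0; -14; -6; -23; 15; 35]; [:: -5; -1; -24; -36; -6;
  -14; 1; 18; 1; 20; -6; -15; 19]; [:: -21; 5; -142; 36; 90; -30; -13; -59; -31; -200; 112; 201; 43;
  91]; [:: -2188; -321; -3614; -2478; 481; -1357; -5303; -712; 5304; -1678; 4165; 1306; 998; -744;
  7660]; [:: -41; -136; 1217; -748; -1052; 338; -99; 719; 316; 1938; -947; -2097; -354; -910; 426;
  412]; [:: 1225; -207; -3528; -5031; 7037; -999; 3264; 2091; -2589; -2840; 2945; -415; 611; -76;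
  -6642; -5023; 6066]; [:: -3284; -2650; -10673; -11630; -402; -1344; -4626; 1843; -4385; -6201; 5238;
  5041; 6068; 3421; 5607; 4693; 2497; 4777]; [:: 1204; -3028; 3178; 6646; -1217; -1307; -6457; -2193;
  6473; 2752; -5372; -3444; 762; -28; 7317; -842; 453; 6385; 9153]; [:: -10816; -5765; 480; 1459;
  -4041; -2720; 4396; -2593; 1989; 4135; 980; 724; -233; 6264; -446; 8206; 6381; 5335; 11329; 16801]];
  [:: [:: 5]; [:: 3; 4]; [:: 0; -2; 10]; [:: 4; 1; 2; 13]; [:: -5; -2; -3; -9; 10]; [:: 0; -8; -1; -2;
  -2; 11]; [:: -14; -11; 6; -20; 10; -8; 10]; [:: 9; 9; 13; 7; -6; -6; -2; 32]; [:: -75; -53; 3; -117;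
  39; -20; 32; -42; 129]; [:: 53; 45; -20; 67; -32; 18; -32; 25; -46; 20]; [:: -11; -7; 3; -7; 7; 1;
  14; -20; -7; -9; 11]; [:: -19; -14; 17; -14; 16; -10; 22; -5; -11; -13; 9; 20]; [:: 283; 203; 3;
  447; -108; 68; -114; 176; -455; 17; -5; 23; 48]; [:: 3005; 2125; 1303; 6462; -396; 392; -418; 3069;
  -5190; -344; 226; 1565; 1466; 2322]; [:: -619; -1638; 1694; 637; 1564; -534; 1971; 1881; 6511; 1046;
  370; 2426; 1505; 5527; 2284]; [:: 5861; 6025; -1046; 6556; -2868; 980; -3070; 4062; -1409; 949; 563;
  -94; 135; -4720; -99; 4579]; [:: -764; -2624; -3786; -556; -611; 4863; -1827; -4097; 6298; 3818;
  -1311; -3167; -1451; 1862; 3378; -1230; 4103]; [:: -750; -111; -4185; -3271; -3336; 5543; -354;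
  -2133; 4984; 11804; 2971; -2983; -2232; 3736; 5222; -4175; 3616; 7493]; [:: -3000; 2695; -3883;
  1449; 890; 5394; -7368; -2696; -1746; 3860; -3789; -1398; 6495; 7664; -13087; -5018; -69; 1811;
  6820]; [:: -1670; 3281; 3272; 4456; 565; 1021; 1808; 4699; -450; 488; 3700; 5217; 3359; 8202; -4189;
  794; 681; 3524; 1326; 2632]]; [:: [:: 57]; [:: 8923; 2218]; [:: -3995; 141; 4063]; [:: 495; 1335;
  3431; 3273]]]; [:: [:: [:: 6]; [:: -5; 3]; [:: 3; -2; 8]; [:: -1; 0; -5; 4]; [:: 2; -2; 2; 0; 20];
  [:: -1; 0; 0; -1; -5; 11]; [:: -2; -3; 1; -1; 1; 4; 5]; [:: 3; -1; 2; -1; 3; 0; -3; 8]; [:: 0; -1;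
  1; -5; -6; -4; 1; 0; 10]; [:: 1; 0; -3; 1; -6; -1; 1; -1; -1; 16]; [:: 3; -2; 0; -3; 10; -9; 0; 1;
  -1; -8; 10]; [:: -2; -1; -5; 4; -7; 10; 2; -1; -6; 6; -7; 15]; [:: 7; -14; 12; -10; 9; -5; 9; -3; 9;
  -7; 7; -3; 12]; [:: -4; 8; -11; 16; -13; 18; -12; 4; -16; 19; -17; 18; -11; 16]; [:: 4; 3; 0; -4;
  -1; -11; 0; 4; 4; -7; 9; -13; -6; -16; 20]; [:: 8; -5; 14; -3; 10; -1; -5; 1; 2; -12; -12; 9; -1;
  11; -14; 21]; [:: -10; 10; -10; 9; -16; 13; 0; -8; -9; 13; -14; -3; -12; -13; 13; -2; 11]; [:: -3;
  16; -30; 20; -6; 13; -13; -9; -33; 27; -26; 18; -26; 8; 0; 17; 2; 41]; [:: 6; -6; 16; -4; 21; -3; 6;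
  5; 1; -45; -2; -10; -6; -37; 7; 18; 11; -20; 48]; [:: 59; -105; 142; -82; 40; -77; 52; 44; 40; -195;
  21; -97; -5; -230; 120; 127; 70; -70; 141; 142]; [:: -8; 144; -173; 162; 76; 107; -155; -42; -93;
  299; -56; 169; 0; 462; -273; -205; -114; 119; -160; -254; 108]; [:: 1000; -1343; 2460; -912; 1930;
  -851; 228; 655; 621; -3594; -33; -911; -6; -2048; 194; 1826; 813; -1402; 2726; 1086; 374; 1627]; [::
  -947; -927; 2634; -6207; -2247; -7402; -125; -2986; 6676; -5319; 3386; -6751; 2610; -636; 1223;
  -2227; 1134; -4707; -4188; -2629; 1050; 1951; 4044]; [:: -1502; -1538; -1613; 1521; -5993; 5292;
  4255; -294; -3692; 3236; -2371; 2163; -1725; -7139; 5387; 4714; 1171; 5025; 511; 7428; -3566; -2739;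
  -3048; 5574]; [:: 593; 1124; -1628; -2524; 3092; -7144; 726; 4448; 745; -8546; 4662; -4854; -2756;
  -13143; 8910; 873; 2074; -5660; 9938; -813; -2836; -5430; 2249; -14501; 2732]; [:: 4382; -9386;
  3541; -4180; 2946; -4020; 2537; -924; -3840; -6158; -149; -5864; -2824; -11760; 5705; 16546; 2463;
  17787; 5343; 18957; 3127; 8271; -3434; 17874; -842; 9074]; [:: -206; 3378; 772; 11292; 2311; 14312;
  -1512; 12268; -2358; 14193; 1119; 13595; 6113; 11646; -2276; -25439; -1857; -28087; 4298; -12313;
  281; -20776; -508; -27604; 3126; -12956; 9948]; [:: -6360; -7977; 659; -2592; -1855; 306; -2246;
  7110; -2803; 4360; -2895; 7484; 2432; 8408; -6104; 14633; -2883; 11563; -4854; 22315; -3375; 8349;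
  -2604; 3358; -1489; 14803; 3352; 17987]]; [:: [:: 13]; [:: 5; 6]; [:: 2; 0; 73]; [:: 3; -4; -17;
  26]; [:: 20; -12; -98; 124; 30]; [:: -19; -9; -15; -3; 1; 25]; [:: -27; 24; -83; 198; 79; 63; 49];
  [:: 3016; -205; 5385; -5788; -2087; -1502; -1882; 2296]; [:: -5201; 690; -97; -4202; -1255; -1377;
  2128; -6230; 2819]; [:: -2476; 4821; 5032; 10808; 8448; 12297; 4447; 10598; -2954; 8825]; [:: -933;
  -2507; -10656; -3395; -4409; 1531; 1471; -12105; 7870; -12506; 7957]; [:: 813; -5655; -3400; -9306;
  -4496; -3730; -3806; 7127; 5617; 31722; 936; 16964]]; [:: [:: 9]; [:: -4; 6]; [:: 3; -1; 11]; [:: 4;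
  -8; 4; 21]; [:: -3; 3; -3; 0; 10]; [:: -12; -18; -7; 47; 14; 42]; [:: 6; 30; 3; -32; -6; -28; 13];
  [:: 59; 219; -5; -409; -42; -269; -10; 118]; [:: -1289; -5631; 707; 10619; 1373; 7011; 147; -2707;
  813]; [:: 5938; 1267; 10785; -5338; -1286; -6747; -576; 2092; 6380; 13374]; [:: 4120; 1485; 2527;
  6589; -658; 1365; 3533; 1265; 334; 7589; 6042]; [:: 3434; 8707; 7201; 9259; 5750; 3093; 8031; 2136;
  9053; 4195; 4466; 6992]]; [:: [:: 14]; [:: 7; 5]; [:: -4; -5; 9]; [:: 2; 0; -1; 22]; [:: 5; -28; 6;
  -37; 54]; [:: -5; -18; -5; -20; 36; 18]; [:: -93; 54; -12; 61; -272; -80; 102]; [:: -3733; 156;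
  -2858; -1959; -3274; -582; 1242; 6033]; [:: -1291; 1831; 1021; 4437; -6685; -1167; 1120; -973;
  1371]; [:: 638; -430; 4514; -7449; 2092; -5892; 2462; -10548; -2478; 13566]; [:: -790; -7043; 8213;
  1967; 3316; -4220; -1034; 4190; 5141; -4328; 8255]; [:: -4379; -162; 2958; -2356; -55; -1078; -1300;
  -3283; -3888; 6521; 8399; 10170]]]; [:: [:: [:: 8]; [:: -4; 4]; [:: -2; -1; 3]; [:: 2; 0; -2; 13];
  [:: -3; 1; -1; -7; 7]; [:: 1; -1; -1; -5; 0; 9]; [:: -11; -4; 3; -5; 1; 0; 10]; [:: 1; 3; -3; 0; 0;
  -15; -2; 17]; [:: 1; 0; 0; -2; -4; -5; 0; 4; 12]; [:: -2; -2; 0; -4; 1; 9; -1; -8; 0; 12]; [:: 10;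
  4; -6; 4; -3; -9; -8; 4; 5; -9; 10]; [:: 52; 17; -26; -13; -4; -9; -50; 6; 12; -8; 24; 87]; [:: 14;
  0; -9; 25; -13; -38; -1; 31; 10; -11; 2; -30; 14]; [:: -45; -28; 22; -13; 6; 70; 41; -49; -19; 28;
  -24; -12; -15; 39]; [:: 40; 16; -16; -24; 6; 29; -77; -40; 2; 6; 14; 40; 4; -13; 91]; [:: -103;
  -141; -73; 114; -166; -165; -137; 142; 129; 162; -185; -873; 257; -24; 864; 425]; [:: 5612; -411;
  -7599; 3432; -4471; -11537; -16490; 7215; 6078; -4259; 3453; -11060; 7695; -4294; 21867; 5417;
  5275]; [:: -3748; -2384; -384; -2067; 356; 4477; -1984; -4609; -1870; 2733; -1028; -2223; 1325; -4;
  6596; 2607; 1915; 3230]; [:: 3380; -2917; -4991; -2016; -1571; 2624; -10572; -3350; 2464; -2559;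
  3965; 6839; 746; 6076; 10688; 117; 4371; -630; 10242]; [:: -8934; -5865; -11060; -7282; -7177;
  -11199; 871; 8072; 4322; 18370; -6079; 834; 8708; 10852; 19550; 35552; -6685; 16107; 29353; 54838]];
  [:: [:: 4]; [:: 6; 8]; [:: 0; 0; 8]; [:: 1; 1; -1; 21]; [:: -4; -5; 2; 3; 17]; [:: -2; -2; -6; -2;
  -5; 9]; [:: 0; -1; 0; -16; -4; -8; 9]; [:: 2; 1; -8; 17; -1; 12; -4; 23]; [:: 4; 4; -5; 6; -4; 4; 0;
  -8; 35]; [:: 4; 4; -13; 16; -4; 17; -8; 14; 5; 21]; [:: 2; 5; 4; 0; 7; 2; 10; -7; 22; 2; 14]; [::
  -90; -101; 120; -76; 81; -87; 33; -158; -17; -107; -9; 174]; [:: 83; 114; -58; 158; 141; 211; 84;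
  353; 50; 177; 212; -224; 195]; [:: 2307; 2972; -1838; 4820; 3342; 5753; 1651; 9179; 1441; 4878;
  5045; -5500; 4779; 810]; [:: 297; 839; 423; -6667; -697; -1098; 4231; 1144; 2910; -176; 2715; -2273;
  -499; -6590; 3583]; [:: 4977; 4652; -1263; 6734; -3405; -785; 3098; -118; 9470; 2009; 225; 1202;
  -12416; -20802; 13025; 16095]; [:: 3430; 6458; 1274; 730; 641; 4731; 3965; 6979; 5292; 6461; 2678;
  -4006; 2244; 3303; 7033; 2009; 12135]; [:: 2671; 433; -2243; 3320; -7547; 1360; 756; 1838; 5320;
  3769; -685; 2213; -4784; -3129; 4909; 6477; -3269; 6706]; [:: -2382; 1870; 4645; -2238; 10841; 5176;
  -4010; -20935; 3615; -10625; 6771; 4422; 10309; -3123; -17500; -19681; -9348; -17659; 11508]; [::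
  1775; -772; 638; -3921; -4452; -5605; -9449; -11692; -16767; -16641; -4863; -6652; 13961; 12377;
  -19307; -18245; -13904; -995; 6843; 22874]]; [:: [:: 10]; [:: -4327; 7743]; [:: 3736; 3808; 8732];
  [:: -235; -6472; 7116; 20884]]]; [:: [:: [:: 5]; [:: 0; 3]; [:: -4; -1; 3]; [:: -6; -3; -2; 4]; [::
  -4; -1; 0; 0; 16]; [:: 25; 15; 1; -14; -11; 19]; [:: 22; 12; -1; -11; -15; 14; 7]; [:: -60; -36; -4;
  32; 11; -39; -6; 12]; [:: -1762; -1866; -698; 1035; -345; -1507; 648; 949; 12885]; [:: -3559; -3426;
  -1580; 2435; -3438; -2822; 858; 2308; 4361; 5201]; [:: -503; -1498; -3570; -7410; -4006; 9703; 7054;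
  10519; 16905; 24722; 33266]]; [:: [:: 6]; [:: 0; 6]; [:: 3; -4; 5]; [:: 1; 7; -3; 3]; [:: 11; 24; 0;
  20; 61]; [:: -16; -44; 11; -36; -136; 63]; [:: 62; -443; 404; -931; -5690; 3018; 1970]; [:: 89;
  1892; -2037; 278; -2946; 4990; 2130; 6312]; [:: 1133; 876; 158; -266; -1923; -4328; 2629; -5607;
  17772]]; [:: [:: 3]; [:: 3; 3]; [:: -1; -2; 6]; [:: 1; 3; -3; 11]; [:: -18; -21; 25; -19; 43]; [::
  29; -4; 48; 56; 13; 100]; [:: 916; -210; 2125; 2352; 980; 4073; 2551]; [:: -507; -739; 11223; 12773;
  12793; 15257; 12473; 12008]]; [:: [:: 7]; [:: 2; 11]; [:: 1091; 1163; 11506]]; [:: [:: 4508]]]])%Z.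

Definition F42_multipliers : seq (Z * Z) := (
  [:: (0, 66); (3, 1); (4, 22427); (5, 27173); (7, 2738); (12, 41681); (13, 27421); (15, 20619); (20,
  1); (21, 5); (23, 21006); (28, 18226); (29, 102767); (31, 25349); (38, 1); (40, 33356); (41, 12432);
  (42, 1); (43, 2); (44, 18671); (45, 72570); (46, 2); (47, 42991); (58, 3003); (59, 2378); (60, 13);
  (61, 4); (62, 33); (63, 44859); (108, 19327); (109, 28886); (110, 98523); (111, 35755); (126,
  23621); (127, 3971); (164, 11496); (167, 1); (168, 30314); (172, 1); (173, 39509); (175, 21503);
  (188, 43827); (189, 14); (191, 1); (204, 22469); (205, 2); (207, 49739); (221, 1); (223, 1); (236,
  63739); (237, 103501); (238, 96207); (239, 193357); (254, 1); (255, 2); (492, 53527); (493, 122191);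
  (495, 119051); (511, 2); (512, 9157); (513, 24469); (515, 4813); (516, 11802); (517, 2); (519, 8);
  (524, 37402); (525, 40223); (527, 1); (531, 19266); (532, 37592); (533, 3); (535, 61818); (540,
  43334); (541, 108270); (543, 17191); (548, 18079); (550, 42501); (551, 1); (553, 1); (554, 1); (556,
  14435); (557, 114757); (558, 1); (559, 10980); (566, 12); (567, 133256); (572, 3); (573, 44256);
  (574, 74660); (575, 77032); (620, 63730); (621, 92774); (622, 108331); (623, 173793); (638, 87260);
  (639, 20924); (677, 4); (680, 5270); (685, 4); (687, 750); (696, 25156); (700, 1); (701, 1); (703,
  1); (716, 15946); (717, 17); (719, 109477); (732, 3043); (733, 25); (735, 12); (748, 129764); (749,
  37162); (750, 110752); (751, 434733); (766, 10); (767, 123819); (1004, 92215); (1005, 40556); (1007,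
  104452); (1023, 71691)])%Z.

Definition F33_factors : seq (seq (seq (seq Z))) := (
  [:: [:: [:: [:: 0; 0; 0; 1]; [:: 0; 0; 0; 0; 0; 2]; [:: 0; 0; 0; 0; 0; 0; 1]; [:: 0; -333; 121; -22;
  0; -98; 10; 3; 72; -52; 94]]; [:: [:: 1]; [:: 0; 1]; [:: 1]; [:: -1]; [:: 0; 0; 0; 0; 0; 2]; [:: -4;
  0; -1; 0; 0; -3; 2]; [:: 1; 0; 0; 0; 0; 2; -2; 1]; [:: -463; -4; -86; 6; 3; -312; 280; -23; 19]];
  [:: [:: 0; 0; 1]; [:: 0; 0; 0; 3]; [:: 0; 0; 0; 0; 2]; [:: 0; 0; 0; -1]; [:: -1]; [:: 227; 81; 61;
  -266; -81; 11; -74; 28]]; [:: [:: 0; 6]; [:: -43; -514; 286]]; [:: [:: 333]]]; [:: [:: [:: 1]; [::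
  0; 0; 1]; [:: 0; 0; 0; 2]; [:: 0; 0; 0; -1; 2]; [:: 0; 0; 0; 0; 0; 2]; [:: 0; 0; 0; -2; -2; 0; 2];
  [:: -1; 0; 0; -2; 0; 0; 1; 2]; [:: 0; 0; -1; 3; 2; -2; -2; -2; 2]; [:: 0; 0; -1; 2; 3; -2; -2; -1;
  1; 2]; [:: 2; -1; 3; 3; -4; 1; 1; -2; -1; -5; 5]; [:: 0; 0; -1; 1; 0; -1; -1; -1; 1; 1; -1; 2]; [::
  4; -4; 8; 5; -11; 4; 4; -5; -3; -10; 9; 0; 6]; [:: -1; 0; 0; -2; 2; -1; 1; 1; -1; 1; -2; 0; 1; 2];
  [:: -45; 14; -101; 168; 130; -134; -180; -122; 128; 107; -53; 42; 14; -5; 42]; [:: -374; -67; -125;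
  -279; 772; -64; -202; 356; -57; 319; -289; -220; -149; 113; 78; 107]; [:: 6; 384; -347; -839; -250;
  -62; 483; 235; 85; 204; -388; 239; -31; -48; -225; -264; 474]; [:: 178; -145; 693; -617; 164; 256;
  153; -274; -335; -860; 308; -25; 532; -2; -175; -219; 722; 512]; [:: 472; 600; 102; -188; 529; 348;
  -20; 320; -55; -904; -333; -324; -291; -383; -461; -861; 759; 675; 641]; [:: -833; -92; 50; 942;
  -389; 148; 276; -879; 153; 784; -281; 245; -170; -296; -607; 706; -229; -575; -355; 911]]; [:: [::
  0; 1]; [:: 0; 0; 1]; [:: 0; 0; 1; 3]; [:: 0; 0; 0; -2; 2]; [:: 0; 0; -2; 0; 0; 1]; [:: 0; -1; 1; 0;
  -1; 0; 1]; [:: 0; 0; 0; 0; -2; 0; 0; 2]; [:: -1; -2; 1; -3; 2; -1; 2; -2; 5]; [:: 0; 0; 2; 1; -1;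
  -1; -1; 0; -1; 1]; [:: 0; 1; 1; 1; -1; 0; 0; 1; -1; 0; 2]; [:: 1; 3; 2; 1; -2; 1; -1; 3; -2; 0; 0;
  4]; [:: -1; -2; 1; 4; -1; -2; -1; -5; 0; 1; 0; -4; 5]; [:: -3; -8; 0; 2; 3; -4; 1; -14; 8; 3; 1;
  -11; 5; 5]; [:: -184; -492; -230; -799; 549; -39; 394; -289; 587; -69; 72; -276; -504; 77; 489]; [::
  -273; -674; 144; -176; 384; -403; 321; -679; 658; 71; -56; -562; 85; -54; 138; 316]; [:: 22; 865;
  -355; 504; -351; 392; -396; 178; -544; 192; 9; 45; 1168; 1; -1332; -836; 497]; [:: -98; -29; 761;
  94; -51; -556; 102; 172; 765; 135; -67; 473; -18; -50; -380; 835; -38; 168]; [:: 319; -13; -547;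
  753; -1024; 713; -891; -159; 133; 236; -453; -35; -197; 674; -236; -227; -540; 80; 664]; [:: 436;
  286; 249; 610; 429; 224; -305; 300; -907; -277; 1024; 808; 774; 2211; -1010; -1021; -659; 27; 380;
  1178]]; [:: [:: 4]; [:: 3; 2]; [:: -4; 0; 3]; [:: -407; -78; 477; 672]]]; [:: [:: [:: 1]; [:: 0; 0;
  2]; [:: 0; 0; 0; 1]; [:: 0; 0; 1; 0; 2]; [:: 0; 0; -1; 0; 0; 1]; [:: 0; 0; 0; 0; 0; 0; 0; 0; 2]; [::
  0; 0; 0; 0; -1; 0; 0; 0; -1; 2]; [:: 0; 0; 0; 0; 0; 0; 0; 0; 0; 0; 0; 1]; [:: -1; 0; 0; 0; 0; 0; 0;
  0; 0; 0; 0; 0; 0; 1]; [:: 0; 0; 0; 0; -1; 0; 0; 0; 0; 0; 0; 0; 0; 0; 2]; [:: 0; 0; 0; 0; -2; -1; 0;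
  0; 0; 0; 0; 1; 0; 0; 0; 3]; [:: 0; 0; -1; 0; 0; 0; 0; 0; 0; -1; 0; 0; 0; 0; 0; 0; 3]; [:: 1; 0; -1;
  0; -1; 0; 0; 0; -1; 1; -1; -1; 0; -1; 1; 0; 1; 2]; [:: 2; 0; -2; 0; -9; -1; 1; 0; 0; 1; -1; -1; 1;
  -2; -1; -2; 4; 2; 7]; [:: 0; 1; 4; -1; 10; 0; 0; -1; 1; 1; 0; 0; -1; 1; 4; 2; -4; -7; -11; 7]; [::
  -9; -4; 2; -2; 25; 10; -4; -1; 0; -8; 7; 8; -2; 9; -6; -2; -16; 7; -7; -21; 5]; [:: 22; 8; -3; 4;
  -54; -24; 9; 2; 3; 21; -17; -19; 6; -22; 15; 3; 33; -25; 12; 55; -12; 3]; [:: 411; 113; 3; 32; -868;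
  -505; 195; -7; 133; 263; -288; -374; 145; -389; 282; -97; 626; -592; 277; 1100; -184; 89; 75]; [::
  -166; -179; -83; -476; -531; -473; -243; 37; -547; 614; -42; -241; 144; 107; 530; 1385; 190; 595;
  -1131; 237; -237; -47; -116; 848]; [:: 87; 522; -170; 991; -237; 1511; 71; 391; -8; 1057; -367; 597;
  -527; -156; -155; -632; -357; -834; -47; -167; 182; -687; -717; -1529; 503]; [:: -792; -40; -208;
  -315; -44; -594; -750; 623; 381; 292; -684; 277; 122; -92; 482; -44; 111; 119; -737; 500; -678; 236;
  966; -197; -626; 642]; [:: 226; 184; 252; 185; 575; -347; 372; 186; 619; -41; 192; 232; -42; -380;
  -273; 797; -331; -231; -421; -522; -437; -536; -39; -1078; 148; -156; 1007]; [:: -132; -116; 359;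
  696; -789; -113; 152; -105; -552; 293; -1173; -442; 174; -22; -1582; 976; -576; 1157; -1010; 1112;
  -1913; 283; -2393; 66; -719; 363; 673; 1929]]; [:: [:: 6]; [:: 0; 1]; [:: 0; 0; 4]; [:: 2; -1; 0;
  4]; [:: 2; 0; 0; 1; 1]; [:: -1; -1; 1; 1; 0; 1]; [:: 1; 0; -1; 0; 0; 0; 2]; [:: 2; 1; 2; 0; 0; -1;
  0; 3]; [:: 3; 1; 5; 1; 0; -1; -1; 3; 4]; [:: 477; 97; -360; -579; 201; -234; 282; 346; 750; 1333];
  [:: 318; -169; 1085; 1127; 627; 735; 490; -683; 1541; 619; 556]; [:: -234; 829; -461; 414; -556;
  952; -297; 328; -425; 1447; 518; 1645]]; [:: [:: 3]; [:: 0; 2]; [:: 0; 1; 1]; [:: 0; 0; 0; 1]; [::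
  1; -1; 0; 0; 1]; [:: -5; -2; 2; 1; -1; 5]; [:: -3; -1; 1; 1; 1; 4; 6]; [:: 9; 6; -3; -1; 0; -10; -5;
  4]; [:: 89; -124; -183; 393; -26; -283; -1161; -238; 552]; [:: -515; -514; 158; 678; 137; 679; -30;
  -414; 697; 272]; [:: 150; -783; -481; -201; 759; 307; 419; -450; -118; -639; 324]; [:: 256; -41;
  792; 163; 1165; 597; -792; 481; 243; -312; 1368; 915]]; [:: [:: 3]; [:: 0; 1]; [:: 0; 0; 3]; [:: 0;
  -1; -1; 2]; [:: -2; -1; 1; 0; 1]; [:: 0; -1; 0; 1; 0; 1]; [:: -3; 0; 1; 0; 0; 0; 5]; [:: 1; 6; -2;
  -5; -3; 1; 10; 6]; [:: 126; -28; 144; 149; 193; -141; -682; -244; 272]; [:: -308; 539; 835; 1014;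
  -53; 342; -88; -480; 2113; 1129]; [:: -372; 50; 1287; 391; 353; -705; -1426; 95; 2161; 67; 545]; [::
  794; 164; 71; 1287; 1159; 1460; 643; -29; 184; 2023; 1052; 1745]]]; [:: [:: [:: 3]; [:: 0; 1]; [::
  0; 0; 0; 2]; [:: 0; 0; 0; 0; 1]; [:: 0; 0; 0; 0; 0; 1]; [:: -1]; [:: -1; 0; 0; 0; 0; 0; 0; 1]; [::
  0; 0; 0; 0; 0; 0; 0; 0; 1]; [:: 1]; [:: 1; 0; 0; 0; 0; 0; 0; 0; 0; 0; 1]; [:: -4; 0; 0; -1; 0; 0; 0;
  0; 0; 0; 0; 1]; [:: -2; -1; 0; 0; 0; 0; 0; 0; 0; 0; 0; 1; 1]; [:: 1; 0; -3; -2; 0; 1; 0; -1; -1; 0;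
  0; 1; 1; 2]; [:: -11; -2; 4; 1; 0; -3; 0; 1; 0; 0; 1; 2; 1; -3; 2]; [:: 1044; -42; -131; 115; -8;
  -20; -124; -129; -93; -119; 172; -171; -126; 173; -83; 161]; [:: 261; -374; 274; 576; -114; -766;
  -532; 78; -132; -464; 876; 25; 173; -371; 496; 185; 311]; [:: -557; 271; 750; 119; -152; 793; 348;
  -239; 447; 126; -742; 277; -1024; 47; -1553; -227; 43; 819]; [:: -516; -445; -347; 536; 387; -521;
  -696; 337; -372; -400; -24; -92; 120; -564; -428; -1315; 1420; 1480; 1347]; [:: -268; 417; 249;
  -209; -951; -977; -533; 445; 575; 119; -1346; -1263; -319; -814; 755; 312; -69; -65; 528; 1626]];
  [:: [:: 1]; [:: 0; 0; 1]; [:: 0; 0; 0; 1]; [:: 0; 0; 0; -1; 1]; [:: 0; 0; 0; 0; 0; 0; 1]; [:: 0; 0;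
  0; 0; 0; 0; 0; 1]; [:: 0; 0; 0; 0; 0; 0; 0; 0; 1]; [:: 0; 0; 0; -1]; [:: 0; 0; 0; 1; 0; 0; 0; 0; 0;
  0; 0; 1]; [:: 0; 0; 0; 1; -1; 0; 0; 0; -1; 0; 0; 0; 1]; [:: 1; 0; 1; 2; 1; 1; 0; 3; -1; 0; 1; 1; 2;
  3]; [:: 0; 0; 1; 1; 1; 0; 1; 2; -1; 0; 1; 1; 1; 1; 1]; [:: 514; 75; -337; 152; -364; 45; -540; -162;
  719; 388; -234; 127; -207; -713; -20; 643]; [:: 719; 96; -479; 187; -515; 45; -760; -257; 1046; 554;
  -347; 167; -322; -1057; -10; 923; 26]; [:: 61; 327; 137; 487; 357; 1120; 95; 355; -172; 218; 723;
  535; 921; 1561; -414; 42; -684; 507]; [:: -412; -157; -17; -492; -83; -175; 208; -1159; 312; 148;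
  -369; -384; -435; -910; -156; -44; 605; 163; 252]; [:: -265; 62; 263; -1208; 914; 315; 325; -82;
  705; -58; 86; 466; -895; 605; 1424; 416; 338; 716; -52; 865]]; [:: [:: 1]; [:: 0; 1]; [:: -28; -335;
  628]; [:: -690; -130; 400; 784]]]; [:: [:: [:: 2]; [:: 0; 1]; [:: -1]; [:: 0; 0; 0; 0; 0; 1]; [::
  -3; -1; 0; 0; 1; -2]; [:: -1; -1; 0; -1; 1; -1; 0; 0; 1]; [:: 476; 94; -5; 102; -324; 399; -77; -59;
  -145; 67]; [:: 17; -815; -716; -480; -519; -241; -86; 14; 1392; 576; 2600]]; [:: [:: 1]; [:: 0; 1];
  [:: 0; -1]; [:: 0; -1]; [:: 0; 1]; [:: 8; 22; -2; 4; 5; 10; 9]; [:: 179; 580; -109; 61; 67; 203;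
  144; 62]; [:: 407; 363; -116; 707; 419; -10; 1209; 278; 1337]]; [:: [:: 0; 0; 1]; [:: 1]; [:: -5; 0;
  4; -2; -2; -4; 6]; [:: -518; -22; 474; -166; -80; -360; 657; 39]]; [:: [:: 0; 1]; [:: 141; -171;
  37]]; [:: [:: 525]]]])%Z.

Definition F33_multipliers : seq (Z * Z) := (
  [:: (1, 1771); (5, 6734); (13, 16214); (15, 2767); (21, 4113); (23, 2682); (29, 2070); (31, 10086);
  (37, 599); (38, 139); (42, 3623); (43, 5968); (45, 3848); (46, 881); (47, 7639); (54, 1673); (60,
  2025); (61, 2685); (63, 14868); (109, 41); (110, 11629); (111, 3597); (165, 1673); (169, 1207);
  (175, 3431); (184, 368); (185, 8666); (188, 5150); (189, 1); (191, 4964); (205, 9691); (207, 7462);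
  (220, 8434); (221, 181); (223, 5227); (238, 11293); (254, 10545); (255, 1772); (493, 11831); (495,
  9937); (511, 3490); (515, 3051); (517, 2117); (525, 12268); (527, 9113); (535, 7138); (540, 476);
  (541, 20351); (543, 9683); (549, 1956); (550, 5152); (551, 3805); (553, 3012); (557, 6723); (558,
  3898); (559, 8792); (566, 1951); (567, 1314); (570, 1757); (575, 6145); (621, 1934); (622, 10025);
  (623, 7325); (638, 1819); (677, 2408); (681, 8400); (683, 2800); (685, 12067); (687, 11078); (697,
  569); (701, 7016); (703, 2844); (717, 12320); (733, 2992); (749, 2196); (750, 13876); (751, 24672);
  (766, 5586); (1005, 12456); (1007, 21334); (1023, 17318)])%Z.

(** The masks mark positions in [triples], vertex labels starting from 0. This one marks 012, 013
    and 023; [present] ignores the bits past the end of a mask. *)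
Definition K4m_mask : seq bool := [:: true; true; true].
Definition F42_mask : seq bool := Eval vm_compute in
  mkseq (fun i => i \in [:: 0; 1; 2; 16; 17; 18; 19]) 20.
Definition F33_mask : seq bool := Eval vm_compute in
  mkseq (fun i => i \in [:: 0; 7; 8; 9; 13; 14; 15; 16; 17; 18]) 20.

(** The factors 250 here and 23 below put the density bound on the scale of the integer squares;
    1668464 is the numerical weight of the K4^- inequality. *)
Definition K4m_certificate (T : trie Z) :=
  [:: (250 * 301, unit_term); (- (250 * 1000), edge_term); (-1, lookup T 0%Z)]%Z.
Definition F42_certificate (T : trie Z) :=
  [:: (23 * 4933327, unit_term); (- (23 * 10000000), edge_term); (-1, lookup T 0%Z);
      (- 1668464, cut_term)]%Z.
(** A refutation: if every co-degree were at least [0.4185 * n], the three terms, each of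
    nonpositive total up to lower order, would have a nonnegative sum, although the first one totals
    [- n ^ 6]. *)
Definition F42_codegree_certificate (T : trie Z) (M : trie Z) :=
  [:: (-1, unit_term); (-1, lookup T 0%Z); (-1, codegree_term M (-4185) (10000 - 4185))]%Z.
(** The edge term replaces the constant, because the positive co-degree condition also holds for the
    edgeless 3-graph; the outcome is that there are no edges. *)
Definition F33_certificate (T : trie Z) (M : trie Z) :=
  [:: (-1, edge_term); (-1, lookup T 0%Z); (-1, codegree_term M (-616) (1000 - 616))]%Z.

Lemma K4m_checked : check_patterns (nonneg_on_free K4m_mask
  (K4m_certificate (sos_trie flag_bases K4m_factors))).
Proof. vm_cast_no_check (erefl true). Qed.

Lemma F42_checked : check_patterns (nonneg_on_free F42_mask
  (F42_certificate (sos_trie flag_bases F42_factors))).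
Proof. vm_cast_no_check (erefl true). Qed.

Lemma F42_codegree_checked : check_patterns (nonneg_on_free F42_mask
  (F42_codegree_certificate (sos_trie flag_bases F42_codegree_factors)
     (branch 10 (fun l => Leaf (multiplier F42_multipliers l))))).
Proof. vm_cast_no_check (erefl true). Qed.

Lemma F33_checked : check_patterns (nonneg_on_free F33_mask
  (F33_certificate (sos_trie flag_bases F33_factors)
     (branch 10 (fun l => Leaf (covered_multiplier F33_multipliers l))))).
Proof. vm_cast_no_check (erefl true). Qed.

(** * Density bounds for ternary relations *)

Section Bounds.
Local Open Scope ring_scope.
Implicit Types V : finType.

Lemma sum_triple V (h : V -> V -> V -> bool) (u v : Z) :
  \sum_a \sum_b \sum_c (u - v * (h a b c)%:R) =
  u * #|V|%:R ^+ 3 - v * triple_count h.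
Proof.
rewrite /triple_count !mulr_sumr -[X in X - _]mulr1 -sumrN.
under eq_bigr => a _.
  under eq_bigr => b _ do rewrite big_split /= sum_cst sumrN -mulr_sumr.
  rewrite big_split /= sum_cst sumrN -mulr_sumr.
  over.
rewrite big_split /= sum_cst sumrN; congr (_ - _).
by rewrite !exprS expr0; ring.
Qed.

(** The certificate reads [250 * (301 * n ^ 6 - 1000 * n ^ 3 * T) >= S >= 0], with [T] the triple
    count, and [n ^ 3] cancels. Sampling with replacement leaves no error term, so the bound applies
    to sets of any size. *)
Lemma K4m_free_triple_count V (h : V -> V -> V -> bool) :
  (forall a b c, h a b c = h b a c) -> (forall a b c, h a b c = h a c b) ->
  (forall a c, h a a c = false) ->
  (forall a b c d, ~~ [&& h a b c, h a b d & h a c d]) ->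
  1000 * triple_count h <= 301 * #|V|%:R ^+ 3.
Proof.
move=> hC hCA hirr free.
have freeE a b c d e f : ~~ present K4m_mask (pattern6 h a b c d e f).
  by have := free a b c d; rewrite /=; case: (h a b c); case: (h a b d); case: (h a c d).
have := certified_total hC hCA hirr K4m_checked freeE.
rewrite !big_cons big_nil /= total_unit_term total_edge_term.
have := total_sos_nonneg h flag_bases K4m_factors; move: (total _ _) => S.
have [n0|n_gt0] := posnP #|V|.
  rewrite /triple_count big_pred0 ?n0 ?mulr0 // => a.
  by have := card0_eq n0 a; rewrite !inE.
set N := _ ^+ 3; have N0 : 0 < N by rewrite exprn_gt0 // ltr0n.
have -> : (#|V|%:R : Z) ^+ 6 = N * N by rewrite -exprD.
move: (triple_count h) N0 => E; move: N => N *; nia.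
Qed.

(** For fixed [a], [b], [c] the cut terms add up to [301 * |S| ^ 3 - 1000 * T], where [T] counts the
    adjacent triples inside [S]; this is the K4^- bound for the relation restricted to [S]. *)
Lemma total_cut_term_nonneg V (h : V -> V -> V -> bool) :
  (forall a b c, h a b c = h b a c) -> (forall a b c, h a b c = h a c b) ->
  (forall a c, h a a c = false) ->
  (forall a b c d e f, ~~ present F42_mask (pattern6 h a b c d e f)) ->
  0 <= total h cut_term.
Proof.
move=> hC hCA hirr free.
apply: sumr_ge0 => a _; apply: sumr_ge0 => b _; apply: sumr_ge0 => c _.
pose S := [pred x | [&& h a b c, h a b x, ~~ h a c x & ~~ h b c x]].
have cut_termE d e f : cut_term (pattern6 h a b c d e f) =
    if d \in S then if e \in S then if f \in S then 301 - 1000 * (h d e f)%:R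
    else 0 else 0 else 0.
  rewrite !inE /cut_term /=; case: (h a b c) => //=.
  case: (h a b d) => //=; case: (h a c d) => //=; case: (h b c d) => //=.
  case: (h a b e) => //=; case: (h a c e) => //=; case: (h b c e) => //=.
  case: (h a b f) => //=; case: (h a c f) => //=; case: (h b c f) => //=.
  by case: (h d e f).
have -> : \sum_d \sum_e \sum_f cut_term (pattern6 h a b c d e f) =
  \sum_(d in S) \sum_(e in S) \sum_(f in S) (301 - 1000 * (h d e f)%:R).
  rewrite [RHS]big_mkcond; apply: eq_bigr => d _; case: ifP => dS; last first.
    by rewrite big1 // => e _; rewrite big1 // => f _; rewrite cut_termE dS.
  rewrite [RHS]big_mkcond; apply: eq_bigr => e _; case: ifP => eS; last first.
    by rewrite big1 // => f _; rewrite cut_termE dS eS.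
  by rewrite [RHS]big_mkcond; apply: eq_bigr => f _; rewrite cut_termE dS eS.
pose h' (x y z : {x in S}) := h (val x) (val y) (val z).
have -> : \sum_(d in S) \sum_(e in S) \sum_(f in S) (301 - 1000 * (h d e f)%:R) =
    301 * #|{: {x in S}}|%:R ^+ 3 - 1000 * triple_count h' :> Z.
  rewrite -sum_triple big_sub; apply: eq_bigr => d _.
  by rewrite big_sub; apply: eq_bigr => e _; rewrite big_sub.
rewrite subr_ge0; apply: K4m_free_triple_count.
- by move=> x y z; exact: hC.
- by move=> x y z; exact: hCA.
- by move=> x z; exact: hirr.
(* A K4^- on [x], [y], [z], [t] in [S], with the edges joining each of these vertices to the pair
   [a], [b], is a copy of [F42]. *)
- move=> x y z t; apply: contra (free (val x) (val y) (val z) (val t) a b).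
  case/and3P; rewrite /h' /= => -> -> ->.
  have rot u v w : h u v w = h v w u by rewrite hC hCA.
  have SE (w : {x in S}) : h (val w) a b = true.
    have : val w \in S := valP w.
    by rewrite !inE => /and4P[_ abw _ _]; rewrite rot.
  by rewrite !SE.
Qed.

(** The certificate reads [23 * (4933327 * n ^ 6 - 10000000 * n ^ 3 * T) >= S + 1668464 * C], and
    both totals on the right are nonnegative. *)
Lemma F42_free_triple_count V (h : V -> V -> V -> bool) :
  (forall a b c, h a b c = h b a c) -> (forall a b c, h a b c = h a c b) ->
  (forall a c, h a a c = false) ->
  (forall a b c d e f, ~~ present F42_mask (pattern6 h a b c d e f)) ->
  10000000%Z * triple_count h <= 4933327%Z * #|V|%:R ^+ 3.
Proof.
move=> hC hCA hirr free.
have := certified_total hC hCA hirr F42_checked free.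
rewrite !big_cons big_nil /= total_unit_term total_edge_term.
have := total_cut_term_nonneg hC hCA hirr free; move: (total h cut_term) => C.
have := total_sos_nonneg h flag_bases F42_factors; move: (total _ _) => S.
have [n0|n_gt0] := posnP #|V|.
  rewrite /triple_count big_pred0 ?n0 ?mulr0 // => a.
  by have := card0_eq n0 a; rewrite !inE.
set N := _ ^+ 3; have N0 : 0 < N by rewrite exprn_gt0 // ltr0n.
have -> : (#|V|%:R : Z) ^+ 6 = N * N by rewrite -exprD.
move: (triple_count h) N0 => E; move: N => N *; nia.
Qed.

Lemma multiplier_ge0 M l : 0 <= multiplier M l.
Proof. by rewrite /multiplier; lia. Qed.

(** Controls the pairs [a = b], whose degree is zero and whose co-degree term may be negative. The
    sum of the absolute values in the table is a bound. *)
Lemma multiplier_bounded M : exists B : Z, forall l, multiplier M l <= B.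
Proof.
exists (\sum_(kc <- M) Z.abs kc.2) => l; rewrite /multiplier; elim: M => [|[k c] M IH] /=.
  by rewrite big_nil.
rewrite big_cons /=; have s0 : 0 <= \sum_(kc <- M) Z.abs kc.2 by apply: sumr_ge0 => ? _; lia.
by move: (\sum_(kc <- M) _) s0 IH => s s0 IH; case: ifP => _; lia.
Qed.

(** Suppose that every pair of distinct vertices has degree at least [0.4185 * n]. Then the
    co-degree total [X] is at least the contribution of the pairs [a = b], which is at least
    [- 4185 * B * n ^ 5], whereas the certificate gives [X <= - n ^ 6]. *)
Lemma F42_free_codegree : exists B : Z,
  forall V (h : V -> V -> V -> bool),
  (forall a b c, h a b c = h b a c) -> (forall a b c, h a b c = h a c b) ->
  (forall a c, h a a c = false) ->
  (forall a b c d e f, ~~ present F42_mask (pattern6 h a b c d e f)) ->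
  B < #|V|%:R ->
  exists2 p : V * V, p.1 != p.2 & 10000%Z * degree h p.1 p.2 < 4185%Z * #|V|%:R.
Proof.
have [B mB] := multiplier_bounded F42_multipliers.
have B0 : 0 <= B by exact: le_trans (mB [::]).
(* Beyond this threshold [n ^ 6] exceeds [4185 * B * n ^ 5]; it is the same for all 3-graphs, as the
   limit requires. *)
exists (4185%Z * B) => V h hC hCA hirr free n_gt.
case: (pickP (fun p : V * V =>
    (p.1 != p.2) && (10000%Z * degree h p.1 p.2 < 4185%Z * #|V|%:R))) => [p /andP[]|no].
  by exists p.
have := certified_total hC hCA hirr F42_codegree_checked free.
rewrite !big_cons big_nil /= total_unit_term total_codegree_term.
have := total_sos_nonneg h flag_bases F42_codegree_factors; move: (total _ _) => S.
set n := (#|V|%:R : Z); set X := (X in _ * X + 0).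
have n0 : 0 < n by apply: le_lt_trans n_gt; rewrite mulr_ge0.
have XB : - (4185%Z * B) * n ^+ 5 <= X.
  (* The lower bound is spread over the diagonal pairs, to be compared with [X] term by term. *)
  have -> : - (4185%Z * B) * n ^+ 5 =
      \sum_(a : V) \sum_(b : V) (if b == a then - (4185%Z * B) * n ^+ 4 else 0).
    under eq_bigr => a _ do rewrite -big_mkcond big_pred1_eq.
    by rewrite sum_cst -/n exprS mulrCA.
  apply: ler_sum => a _; apply: ler_sum => b _.
  rewrite -/n; have [-> | ba] := eqVneq b a.
    have -> : - (4185%Z * B) * n ^+ 4 = \sum_(c : V) \sum_(d : V) \sum_(e : V) (- (4185%Z * B) * n).
      by rewrite !sum_cst -/n; ring.
    apply: ler_sum => c _; apply: ler_sum => d _; apply: ler_sum => e _.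
    rewrite /degree big1 => [|f _]; last by rewrite hirr.
    have := mB (take 10 (pattern6 h a a c d e a)); move: (multiplier _ _) => m mB'.
    by clear X; rewrite -/n; move: (n) n0 => k k0; nia.
  do 3!(apply: sumr_ge0 => ? _); apply: mulr_ge0; first exact: multiplier_ge0.
  have := no (a, b); rewrite /= eq_sym ba /= => /negbT; rewrite -leNgt -/n; lia.
rewrite exprS; have := exprn_gt0 5 n0; move: (n ^+ 5) XB n_gt n0.
rewrite -/n; move: X (n) => {}X k k5 *; nia.
Qed.

(** The certificate makes [- n ^ 3 * T] at least a sum of nonnegative totals. The multipliers vanish
    unless the first two vertices lie in an edge, hence also when they coincide, so no threshold on
    [n] appears. *)
Lemma F33_free_codegree V (h : V -> V -> V -> bool) :
  (forall a b c, h a b c = h b a c) -> (forall a b c, h a b c = h a c b) ->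
  (forall a c, h a a c = false) ->
  (forall a b c d e f, ~~ present F33_mask (pattern6 h a b c d e f)) ->
  (forall a b c, h a b c -> 616%Z * #|V|%:R <= 1000%Z * degree h a b) ->
  triple_count h <= 0.
Proof.
move=> hC hCA hirr free deg.
have := certified_total hC hCA hirr F33_checked free.
rewrite !big_cons big_nil /= total_edge_term total_codegree_term.
have := total_sos_nonneg h flag_bases F33_factors; move: (total _ _) => S.
have [n0|n_gt0] := posnP #|V|.
  rewrite /triple_count big_pred0 // => a.
  by have := card0_eq n0 a; rewrite !inE.
set N := _ ^+ 3; have N0 : 0 < N by rewrite exprn_gt0 // ltr0n.
set X := (X in _ * X + 0); have X0 : 0 <= X.
  do 5!(apply: sumr_ge0 => ? _); rewrite /covered_multiplier /=.
  case: ifP => [cov|_]; last by rewrite mul0r.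
  apply: mulr_ge0; first exact: multiplier_ge0.
  by case/or3P: cov => /deg; clear; move: (degree _ _ _) (#|V|%:R : Z) => d k; lia.
move: (triple_count h) N0 X0 => E; move: N X => N X *; nia.
Qed.
End Bounds.

(** * 3-graphs *)

Section Adjacency.
Variables (V : finType) (H : threegraph V).

Definition adj (a b c : V) : bool := [set a; b; c] \in edges H.

Lemma card_edge e : e \in edges H -> #|e| = 3.
Proof. by move=> eH; have /forall_inP/(_ e eH)/eqP := edges_uniform3 H. Qed.

Lemma adjC a b c : adj a b c = adj b a c.
Proof. by rewrite /adj (setUC [set a]). Qed.

Lemma adjCA a b c : adj a b c = adj a c b.
Proof. by rewrite /adj setUAC. Qed.

Lemma adj_irr a c : adj a a c = false.
Proof.
apply/negP => /card_edge; rewrite setUid => e3.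
by have := cards2 a c; rewrite e3; case: (a != c).
Qed.

Lemma adj_neq a b c : adj a b c -> [&& a != b, a != c & b != c].
Proof.
move=> abc; apply/and3P; split; apply: contraTneq abc => eq_xy.
- by rewrite eq_xy adj_irr.
- by rewrite eq_xy adjCA adj_irr.
- by rewrite eq_xy adjC adjCA adj_irr.
Qed.

Lemma edgeP e : e \in edges H -> exists a b c, e = [set a; b; c] /\ adj a b c.
Proof.
move=> eH; have := card_edge eH; rewrite cardE => e3.
have eE : e = [set x in enum e] by apply/setP => x; rewrite inE mem_enum.
case enumE: (enum e) e3 => [|a [|b [|c [|? ?]]]] // _.
have e_abc : e = [set a; b; c].
  by rewrite eE enumE; apply/setP => x; rewrite !inE orbA.
by exists a, b, c; split=> //; rewrite /adj -e_abc.
Qed.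

(** The adjacent ordered triples are grouped by the edge they span, and each edge is spanned by its
    six orderings. *)
Lemma edges_triple_count : ((6 * #|edges H|)%:R <= triple_count adj :> Z)%R.
Proof.
have -> : triple_count adj =
    (\sum_(t : V * V * V) (adj t.1.1 t.1.2 t.2 : nat))%:R%R.
  by rewrite natr_sum /triple_count !pair_bigA.
rewrite ler_nat -sum1_card big_distrr /=.
have -> : \sum_(t : V * V * V) adj t.1.1 t.1.2 t.2 =
    \sum_(e in edges H) \sum_(t : V * V * V | [set t.1.1; t.1.2; t.2] == e) 1.
  rewrite (exchange_big_dep xpredT) //=; apply: eq_bigr => t _; rewrite /adj.
  case: (boolP (_ \in _)) => [tH|tH].
    rewrite (bigD1 [set t.1.1; t.1.2; t.2]) ?eqxx ?tH //= big1 // => e /andP[/andP[_ /eqP <-]].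
    by rewrite eqxx.
  rewrite big1 // => e /andP[eH /eqP te]; by rewrite te eH in tH.
apply: leq_sum => e /edgeP[a [b [c [-> /adj_neq/and3P[ab ac bc]]]]].
rewrite sum1_card muln1.
pose s := [:: (a, b, c); (a, c, b); (b, a, c); (b, c, a); (c, a, b); (c, b, a)].
have us : uniq s.
  rewrite /= !inE !xpair_eqE !eqxx ?(eq_sym b a) ?(eq_sym c a) ?(eq_sym c b).
  by rewrite (negbTE ab) (negbTE ac) (negbTE bc).
have <- : #|s| = 6 by apply/card_uniqP.
apply: subset_leq_card; apply/subsetP => t.
rewrite !inE => ts; change ([set t.1.1; t.1.2; t.2] == [set a; b; c]).
apply/eqP/setP => x; rewrite !inE.
by move: ts; do ?[case/orP]; move=> /eqP-> /=;
  case: (x == a); case: (x == b); case: (x == c).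
Qed.

(** Each edge containing the pair is the image of its third vertex under [c |-> [set a; b; c]]. *)
Lemma codegree_le_degree a b : a != b ->
  ((codegree H [set a; b])%:R <= degree adj a b)%R.
Proof.
move=> ab; rewrite /degree -natr_sum ler_nat.
rewrite -big_mkcond sum1_card.
apply: leq_trans (leq_imset_card (fun c => [set a; b; c]) _).
apply: subset_leq_card; apply/subsetP => e; rewrite inE => /andP[eH sub].
have : #|e :\: [set a; b]| == 1.
  by rewrite cardsD (setIidPr sub) (card_edge eH) cards2 ab.
case/cards1P => c ec; have eE : e = [set a; b; c].
  by rewrite -ec -{1}(setID e [set a; b]) (setIidPr sub).
by apply/imsetP; exists c => //; rewrite unfold_in /= /adj -eE.
Qed.

Lemma copy_of_list (F : threegraph 'I_6) (s : seq V) (d : V) :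
  size s = 6 -> uniq s ->
  (forall e, e \in edges F -> [set nth d s i | i : 'I_6 in e] \in edges H) ->
  contains_copy H F.
Proof.
move=> s6 us sF; apply/existsP; exists [ffun i : 'I_6 => nth d s i].
apply/andP; split.
  apply/injectiveP => i j; rewrite !ffunE => /eqP.
  by rewrite nth_uniq ?s6 // => /eqP/ord_inj.
by apply/forall_inP => e eF; rewrite (eq_imset _ (ffunE _)); exact: sF.
Qed.

Lemma imset_tri (s : seq V) (d : V) i j k : 0 < i <= 6 -> 0 < j <= 6 -> 0 < k <= 6 ->
  [set nth d s x | x : 'I_6 in tri i j k] = [set nth d s i.-1; nth d s j.-1; nth d s k.-1].
Proof.
case/andP=> i0 i6; case/andP=> j0 j6; case/andP=> k0 k6.
by rewrite /tri !imsetU !imset_set1 /vtx !inordK ?prednK.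
Qed.

Lemma present_F42 a b c d e f : present F42_mask (pattern6 adj a b c d e f) =
  [&& adj a b c, adj a b d, adj a c d, adj a e f, adj b e f, adj c e f & adj d e f].
Proof. by rewrite /F42_mask /=; do 7!case: (adj _ _ _). Qed.

Lemma present_F33 a b c d e f : present F33_mask (pattern6 adj a b c d e f) =
  [&& adj a b c, adj a d e, adj b d e, adj c d e, adj a d f, adj b d f, adj c d f,
      adj a e f, adj b e f & adj c e f].
Proof. by rewrite /F33_mask /=; do 10!case: (adj _ _ _). Qed.

Lemma F42_free_pattern : ~~ contains_copy H F42 ->
  forall a b c d e f, ~~ present F42_mask (pattern6 adj a b c d e f).
Proof.
move=> free a b c d e f; apply: contra free; rewrite present_F42.
case/and5P=> abc abd acd aef /and3P[bef cef def].
apply: (@copy_of_list _ [:: a; b; c; d; e; f] a) => //.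
  (* Each of the fifteen pairs lies in one of the seven edges, which makes the six vertices
     distinct. *)
  have /and3P[ab ac bc] := adj_neq abc; have /and3P[_ ad bd] := adj_neq abd.
  have /and3P[_ _ cd] := adj_neq acd; have /and3P[ae af ef] := adj_neq aef.
  have /and3P[be bf _] := adj_neq bef; have /and3P[ce cf _] := adj_neq cef.
  have /and3P[de df _] := adj_neq def.
  by rewrite /= !inE !negb_or ab ac ad ae af bc bd be bf cd ce cf de df ef.
move=> t; rewrite !inE -!orbA.
by do ![case/orP]; move=> /eqP->; rewrite imset_tri.
Qed.

Lemma F33_free_pattern : ~~ contains_copy H F33 ->
  forall a b c d e f, ~~ present F33_mask (pattern6 adj a b c d e f).
Proof.
move=> free a b c d e f; apply: contra free; rewrite present_F33.
case/and5P=> abc ade bde cde /and5P[adf bdf cdf aef /andP[bef cef]].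
apply: (@copy_of_list _ [:: a; b; c; d; e; f] a) => //.
  have /and3P[ab ac bc] := adj_neq abc; have /and3P[ad ae de] := adj_neq ade.
  have /and3P[bd be _] := adj_neq bde; have /and3P[cd ce _] := adj_neq cde.
  have /and3P[_ af df] := adj_neq adf; have /and3P[_ bf _] := adj_neq bdf.
  have /and3P[_ cf _] := adj_neq cdf; have /and3P[_ _ ef] := adj_neq aef.
  by rewrite /= !inE !negb_or ab ac ad ae af bc bd be bf cd ce cf de df ef.
move=> t; rewrite inE => /orP[|/imset2P[x yz xA]].
  by rewrite inE => /eqP->; rewrite imset_tri.
rewrite inE => /andP[yzB yz2] ->.
have [y [z [yzE yz_in]]] : exists y z, yz = [set vtx y; vtx z] /\
    ((y, z) \in [:: (4, 5); (4, 6); (5, 6)]).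
  (* A pair inside [tri 4 5 6] is the complement of a single vertex there, which leaves three
     cases. *)
  have yzC : yz = tri 4 5 6 :\: (tri 4 5 6 :\: yz).
    by rewrite setDDr setDv set0U (setIidPr yzB).
  have : #|tri 4 5 6 :\: yz| == 1 by rewrite cardsD (setIidPr yzB) (eqP yz2) card_tri.
  case/cards1P => w wE.
  have : w \in tri 4 5 6 by have := set11 w; rewrite -wE inE => /andP[].
  rewrite yzC wE !inE -orbA => /or3P[] /eqP->.
  - exists 5, 6; split=> //; apply/setP => u; rewrite !inE -!(val_eqE u) /= !inordK //.
    by case: u => [[|[|[|[|[|[|u]]]]]] ?].
  - exists 4, 6; split=> //; apply/setP => u; rewrite !inE -!(val_eqE u) /= !inordK //.
    by case: u => [[|[|[|[|[|[|u]]]]]] ?].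
  - exists 4, 5; split=> //; apply/setP => u; rewrite !inE -!(val_eqE u) /= !inordK //.
    by case: u => [[|[|[|[|[|[|u]]]]]] ?].
have -> : x |: yz = [set x; vtx y; vtx z] by rewrite yzE setUA.
move: xA; rewrite !inE -orbA => /or3P[] /eqP->; move: yz_in; rewrite !inE;
  do ?[case/orP] => /eqP[-> ->]; by rewrite -/(tri _ _ _) imset_tri.
Qed.
End Adjacency.

(** * Bounds for the extremal numbers *)

Lemma leq_mul_bigmax (I : finType) (P : pred I) (F : I -> nat) (m k : nat) :
  (forall i, P i -> m * F i <= k) -> m * \max_(i | P i) F i <= k.
Proof.
move=> mF; apply: (big_ind (fun x => m * x <= k)) => //; first by rewrite muln0.
by move=> x y; rewrite /maxn; case: ifP.
Qed.

(** The constants stay products and powers of small numerals, because 10 ^ 7 is unwieldy as a unary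
    number; this and the next three casts follow that shape. *)
Lemma natrXMM (R : pzRingType) (a b d k : nat) :
  ((a ^ d * b * k)%:R = a%:R ^+ d * (b * k)%:R :> R)%R.
Proof. by rewrite -mulnA natrM natrX. Qed.

Lemma natrMXDMX (R : pzRingType) (a b c k : nat) :
  (((a * b ^ 3 + c) * k ^ 3)%:R = (a%:R * b%:R ^+ 3 + c%:R) * k%:R ^+ 3 :> R)%R.
Proof. by rewrite (natrM _ (_ + _)) natrD (natrM _ a) (natrX _ b) (natrX _ k). Qed.

Lemma ler_natXM (R : numDomainType) (a b c k n : nat) :
  (a%:R ^+ b * k%:R <= c%:R * n%:R :> R)%R = (a ^ b * k <= c * n).
Proof. by rewrite -natrX -!natrM ler_nat. Qed.

Lemma ler_natMX (R : numDomainType) (a b c k n : nat) :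
  (c%:R * n%:R <= a%:R ^+ b * k%:R :> R)%R = (c * n <= a ^ b * k).
Proof. by rewrite -natrX -!natrM ler_nat. Qed.

Lemma turan_number_F42 n :
  10 ^ 7 * 6 * turan_number F42 n <= (4933 * 10 ^ 3 + 327) * n ^ 3.
Proof.
apply: leq_mul_bigmax => H free.
have := F42_free_triple_count (@adjC _ H) (@adjCA _ H) (@adj_irr _ H) (F42_free_pattern free).
rewrite card_ord => le.
have {}le : (10000000%Z * (6 * #|edges H|)%:R <= 4933327%Z * n%:R ^+ 3 :> Z)%R.
  by apply: le_trans le; rewrite ler_pM2l //; exact: edges_triple_count.
by rewrite -(ler_nat Z) natrXMM natrMXDMX.
Qed.

Lemma min_codegree_le (V : finType) (H : threegraph V) (p : {set V}) :
  #|p| == 2 -> min_codegree H <= codegree H p.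
Proof.
move=> p2; rewrite /min_codegree; have := mem_index_enum p.
elim: (index_enum _) => //= q r IH; rewrite big_cons inE => /orP[/eqP <-|/IH le].
  by rewrite p2 geq_minl.
by case: ifP => // _; rewrite geq_min le orbT.
Qed.

Lemma coex_F42 : exists B, forall n, B < n -> 10 ^ 4 * coex F42 n <= 4185 * n.
Proof.
have [B degB] := F42_free_codegree.
exists (Z.to_nat B) => n Bn.
apply: leq_mul_bigmax => H free.
have [|[a b] /= ab] := degB _ _ (@adjC _ H) (@adjCA _ H) (@adj_irr _ H) (F42_free_pattern free).
  by rewrite card_ord; lia.
rewrite card_ord => /ltW le.
have codeg := codegree_le_degree H ab.
have mc := min_codegree_le H (p := [set a; b]); rewrite cards2 ab in mc.
rewrite -(ler_natXM Z); apply: le_trans le.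
have -> : (10%:R ^+ 4 = 10000%Z :> Z)%R by [].
rewrite ler_pM2l //.
by apply: le_trans codeg; rewrite ler_nat mc.
Qed.

Lemma pos_coex_F33 n : 10 ^ 3 * pos_coex F33 n <= 616 * n.
Proof.
apply: leq_mul_bigmax => H free; rewrite /min_pos_codegree; case: ifP => [_|/negbT/set0Pn[e eH]].
  by rewrite muln0.
(* A [k] above [0.616 * n] would give every covered pair the degree that the certificate asks for,
   which leaves no edge, although [e] is one. *)
apply: leq_mul_bigmax => k /forallP kP; rewrite leqNgt; apply/negP => lt.
have := F33_free_codegree (@adjC _ H) (@adjCA _ H) (@adj_irr _ H) (F33_free_pattern free).
have deg a b c : adj H a b c ->
    (616%Z * #|'I_n|%:R <= 1000%Z * degree (adj H) a b :> Z)%R.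
  move=> abc; have /and3P[ab _ _] := adj_neq abc.
  have := kP [set a; b]; rewrite cards2 ab /= => /implyP kab.
  have {}kab : k <= codegree H [set a; b].
    apply: kab; apply/exists_inP; exists [set a; b; c] => //.
    by apply/subsetP => x; rewrite !inE => ->.
  have := codegree_le_degree H ab; rewrite card_ord; move: (degree _ _ _) => d cd.
  have {}cd : (k%:R <= d)%R by apply: le_trans cd; rewrite ler_nat.
  apply: (@le_trans _ _ (1000%Z * k%:R)%R); last by rewrite ler_pM2l.
  by have := ltnW lt; rewrite -(ler_natMX Z).
move=> /(_ deg) E0; have := le_trans (edges_triple_count H) E0.
by rewrite (lern0 Z) muln_eq0 /= cards_eq0 => /eqP H0; rewrite H0 inE in eH.
Qed.

(** * Passage to the limit *)

Section Limits.
Variable R : realType.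
Import numFieldNormedType.Exports.
Local Open Scope ring_scope.
Local Open Scope classical_set_scope.

Lemma limn_le_eventually (u : R ^nat) (c : R) : 0 <= c ->
  (forall e, 0 < e -> \forall n \near \oo, u n <= c + e) -> limn u <= c.
Proof.
(* On a divergent sequence [limn] takes the default value [point = 0]. *)
move=> c0 uc; have [cu|/dvgP ->] := pselect (cvgn u); last by [].
by apply/ler_addgt0Pr => e /uc; exact: limr_le.
Qed.

Lemma limn_ratio_le (v : nat -> nat) (c d B : nat) : (0 < d)%N ->
  (forall n, (B < n)%N -> (d * v n <= c * n)%N) ->
  limn (fun n => (v n)%:R / n%:R : R) <= c%:R / d%:R.
Proof.
move=> d0 vn; apply: limn_le_eventually => [|e e0]; first by rewrite divr_ge0.
near=> n; have n_gtB : (B < n)%N by near: n; exact: nbhs_infty_gt.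
apply: ler_wpDr; first exact: ltW.
have n0 : 0 < n%:R :> R by rewrite ltr0n (leq_ltn_trans _ n_gtB).
rewrite ler_pdivrMr // mulrAC ler_pdivlMr ?ltr0n // mulrC -!natrM ler_nat.
exact: vn.
Unshelve. all: by end_near.
Qed.

(** Replaces [n ^ 3] by [6 * 'C(n, 3)] at the cost of an arbitrarily small [e]. In the factored
    difference, [e * x >= 9 * c] and [x > 5] make every summand nonnegative. *)
Lemma cubic_le (c e x : R) : 0 <= c -> 0 < e -> 5 < x -> 9 * c <= e * x ->
  c * x ^+ 3 <= (c + e) * (x * (x - 1) * (x - 2)).
Proof.
move=> c0 e0 x5 ce; rewrite -subr_ge0.
have -> : (c + e) * (x * (x - 1) * (x - 2)) - c * x ^+ 3 =
  x * ((e * x - 9 * c) * (x - 3) + 2 * e + c * (6 * x - 25)) by ring.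
apply: mulr_ge0; first by lra.
by rewrite !addr_ge0 ?mulr_ge0 //; lra.
Qed.

Lemma turan_density_F42 : turan_density R F42 <= (4933 * 10 ^+ 3 + 327) / 10 ^+ 7.
Proof.
set c := (X in _ <= X); have c0 : 0 <= c by rewrite /c; lra.
apply: limn_le_eventually => // e e0.
near=> n.
have n5 : (5 < n)%N by near: n; exact: nbhs_infty_gt.
have ne : 9 * c <= e * n%:R.
  rewrite mulrC -ler_pdivrMl //; near: n; exact: nbhs_infty_ger.
have bin : ('C(n, 3))%:R * 6 = n%:R * (n%:R - 1) * (n%:R - 2) :> R.
  have := bin_ffact n 3; rewrite -[3`!]/6%N => /(congr1 (fun m => m%:R : R)).
  rewrite natrM => ->.
  have -> : n ^_ 3 = (n * (n - 1) * (n - 2))%N.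
    by rewrite !ffactnS ffactn0 muln1 mulnA -!subn1 -subnDA.
  by rewrite !natrM !natrB // ltnW // (leq_trans _ n5).
have tn : (turan_number F42 n)%:R * 6 <= c * n%:R ^+ 3.
  have := turan_number_F42 n; rewrite -(ler_nat R) natrXMM natrMXDMX (natrM _ 6).
  move=> le; rewrite /c mulrAC ler_pdivlMr ?exprn_gt0 //.
  by rewrite mulrC (mulrC _ 6%:R).
have n5R : 5 < n%:R :> R by rewrite ltr_nat.
have b0 : 0 < ('C(n, 3))%:R :> R by rewrite ltr0n bin_gt0 (leq_trans _ n5).
rewrite ler_pdivrMr //.
rewrite -(ler_pM2r (ltr0n R 6)) -mulrA bin; apply: le_trans tn _.
exact: cubic_le.
Unshelve. all: by end_near.
Qed.
End Limits.

Unset Implicit Arguments.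
Local Open Scope ring_scope.

Theorem theorem2p6 (R : realType) :
  [/\ turan_density R F42 <= (4933 * 10 ^+ 3 + 327) / 10 ^+ 7,
      codegree_density R F42 <= 4185 / 10 ^+ 4
    & pos_codegree_density R F33 <= 616 / 10 ^+ 3].
Proof.
split; first exact: turan_density_F42.
- have [B coexB] := coex_F42.
  have := limn_ratio_le R (c := 4185) (d := 10 ^ 4) (B := B) (v := coex F42).
  by rewrite natrX; apply.
- have := limn_ratio_le R (c := 616) (d := 10 ^ 3) (B := 0) (v := pos_coex F33).
  by rewrite natrX; apply => // n _; exact: pos_coex_F33.
Qed.
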